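(* Offensive Alliance parameterized by the solution size and the vertex cover number combined does not admit a polynomial compression unless $\mathrm{coNP}\subseteq \mathrm{NP/poly}$.
   Context: All graphs are finite, simple and undirected. For $S\subseteq V(G)$, $N(S)$ is the open neighbourhood of $S$, $S^c=V(G)\setminus S$, and $d_S(v)$ is the number of neighbours of $v$ in $S$. A non-empty set $S\subseteq V(G)$ is an offensive alliance if $d_S(v)\ge d_{S^c}(v)+1$ for every $v\in N(S)$. Offensive Alliance: given a graph $G$ and integer $r\ge 1$, is there an offensive alliance $S$ with $1\le |S|\le r$? The parameter is $r$ plus the vertex cover number of $G$. *)

(* Defs.v *)
From HB Require Import structures.
From mathcomp Require Import all_boot all_algebra.

Set Implicit Arguments.
Unset Strict Implicit.
Unset Printing Implicit Defensive.

(* Graphs *)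

Section Graphs.

Variables (T : finType) (e : rel T).
Implicit Types (S C : {set T}) (v : T).

(* The vertices outside S that have a neighbour in S. *)
Definition open_nbh S : {set T} :=
  [set v | (v \notin S) && [exists u in S, e u v]].

Definition deg_in S v : nat := #|[set u in S | e v u]|.

Definition offensive_alliance S : bool :=
  (S != set0) && [forall v in open_nbh S, deg_in (~: S) v + 1 <= deg_in S v].

Definition vertex_cover C : bool :=
  [forall u, forall v, e u v ==> (u \in C) || (v \in C)].

Definition vertex_cover_number : nat :=
  #|[arg min_(C < [set: T] | vertex_cover C) #|C|]|.

End Graphs.

(* Turing machines *)

(* A tape cell is blank (None) or holds a bit.  A tape is two-way infinite:
   (l, r) lists the cells to the left of the head, nearest first, and the
   cells from the head rightwards; all cells not listed are blank. *)
Definition cell : Type := option bool.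
Definition tape : Type := (seq cell * seq cell)%type.
Variant move : Type := MoveLeft | Stay | MoveRight.

Definition tape_read (t : tape) : cell := head None t.2.

Definition tape_write_move (t : tape) (a : cell) (m : move) : tape :=
  let: (l, r) := t in
  match m with
  | MoveLeft => (behead l, head None l :: a :: behead r)
  | Stay => (l, a :: behead r)
  | MoveRight => (a :: l, behead r)
  end.

(* Deterministic machine with tm_tapes.+1 tapes. *)
Record turing_machine : Type := TuringMachine {
  tm_tapes : nat;
  tm_state : finType;
  tm_start : tm_state;
  tm_halt : pred tm_state;
  tm_delta : tm_state -> {ffun 'I_tm_tapes.+1 -> cell} ->
             tm_state * {ffun 'I_tm_tapes.+1 -> cell * move}
}.

Section Run.

Variable M : turing_machine.

Definition config : Type :=
  (tm_state M * {ffun 'I_(tm_tapes M).+1 -> tape})%type.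

Definition tm_step (c : config) : config :=
  let: (q, ts) := c in
  if tm_halt q then c else
  let: (q', act) := tm_delta q [ffun i => tape_read (ts i)] in
  (q', [ffun i => tape_write_move (ts i) (act i).1 (act i).2]).

(* The i-th input string is written on the i-th tape. *)
Definition tm_init (xs : seq bitseq) : config :=
  (tm_start M,
   [ffun i : 'I_(tm_tapes M).+1 => ([::], map Some (nth [::] xs i)) : tape]).

Fixpoint bits_upto_blank (r : seq cell) : bitseq :=
  if r is Some b :: r' then b :: bits_upto_blank r' else [::].

(* The output starts at the head of the first tape. *)
Definition tm_output (c : config) : bitseq := bits_upto_blank (c.2 ord0).2.

Definition computes_within (n : nat) (xs : seq bitseq) (y : bitseq) : Prop :=
  let c := iter n tm_step (tm_init xs) in tm_halt c.1 /\ tm_output c = y.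

End Run.

(* Complexity classes *)

Definition language : Type := bitseq -> Prop.

Definition poly_time (m : nat) (f : m.-tuple bitseq -> bitseq) : Prop :=
  exists (M : turing_machine) (p : {poly nat}), forall xs : m.-tuple bitseq,
    computes_within M p.[sumn (map size xs)]%R xs (f xs).

Definition NP (L : language) : Prop :=
  exists (V : 2.-tuple bitseq -> bitseq) (p : {poly nat}),
    poly_time V /\
    forall x, L x <->
      exists w : bitseq,
        size w <= p.[size x]%R /\ V [tuple x; w] = [:: true].

Definition coNP (L : language) : Prop := NP (fun x => ~ L x).

(* The advice string a n depends on the input length n only. *)
Definition NP_poly (L : language) : Prop :=
  exists (V : 3.-tuple bitseq -> bitseq) (p q : {poly nat}) (a : nat -> bitseq),
    [/\ poly_time V,
        forall n, size (a n) <= q.[n]%R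
      & forall x, L x <->
          exists w : bitseq,
            size w <= p.[size x]%R /\ V [tuple x; a (size x); w] = [:: true]].

(* Parameterized problems *)

Record param_problem : Type := ParamProblem {
  pp_instance : Type;
  pp_encode : pp_instance -> bitseq;
  pp_param : pp_instance -> nat;
  pp_yes : pp_instance -> Prop
}.

(* The compressing algorithm f is given the encoded instance together with its
   parameter in unary, so that polynomial time means polynomial in |x| + k.
   The target language R is arbitrary, possibly undecidable. *)
Definition admits_poly_compression (P : param_problem) : Prop :=
  exists (R : language) (f : 2.-tuple bitseq -> bitseq) (p : {poly nat}),
    poly_time f /\
    forall I : pp_instance P,
      let k := pp_param I in
      let y := f [tuple pp_encode I; nseq k true] in
      size y <= p.[k]%R /\ (R y <-> pp_yes I).

(* Offensive Alliance *)

Record oa_instance : Type := OAInstance {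
  oa_order : nat;
  oa_adj : rel 'I_oa_order;
  oa_adj_sym : symmetric oa_adj;
  oa_adj_irr : irreflexive oa_adj;
  oa_size : nat;
  oa_size_gt0 : 0 < oa_size
}.

(* 1^n 0, the adjacency matrix row by row, 1^r. *)
Definition oa_encode (I : oa_instance) : bitseq :=
  nseq (oa_order I) true ++ false ::
  [seq oa_adj u v | u <- enum 'I_(oa_order I), v <- enum 'I_(oa_order I)] ++
  nseq (oa_size I) true.

Definition oa_param (I : oa_instance) : nat :=
  oa_size I + vertex_cover_number (@oa_adj I).

Definition oa_yes (I : oa_instance) : Prop :=
  exists S : {set 'I_(oa_order I)},
    offensive_alliance (@oa_adj I) S /\ 1 <= #|S| <= oa_size I.

Definition OffensiveAlliance : param_problem :=
  ParamProblem oa_encode oa_param oa_yes.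

(* Main.v *)
(* A language [L] with complement in NP is put in NP/poly by the argument of
   Fortnow and Santhanam.  The computations of the verifier on the inputs of
   length [n] are described by a constraint system with one-hot variables; with
   [m = O(log n)] selector variables, a single system expresses that some member
   of a family of [t = d ^ m] inputs lies outside [L].  The system is a hitting
   set instance over a universe of size poly(n) + O(m), hence an Offensive
   Alliance instance of parameter poly(n) + O(m), which the compression maps to
   fewer than [t] bits.  By pigeonhole, at most [n + 1] compressed strings
   account for all [x] in [L] of length [n]: each such [x] belongs to a family
   of members of [L] that is compressed to one of these strings.  The advice
   lists these strings, and the witness is such a family.  The reduction need
   not be computed from scratch: since advice is non-uniform, it contains, for
   each position of [x] in the family, a straight-line program that writes the
   encoded instance, whose bits are constants or (negated) input bits.  So the
   only machine to build is an interpreter that calls the compression machine. *)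

Require Import Defs.
From HB Require Import structures.
From mathcomp Require Import all_boot all_order all_algebra.
From mathcomp Require Import boolp zify.

Set Implicit Arguments.
Unset Strict Implicit.
Unset Printing Implicit Defensive.

Import Order.TTheory GRing.Theory Num.Theory.

(** * Turing machines *)

(* Head-relative view of a tape: cell 0 is the one under the head. *)
Definition tape_fun (t : tape) (z : int) : cell :=
  match z with Posz n => nth None t.2 n | Negz n => nth None t.1 n end.

Definition offset (m : move) : int :=
  (match m with MoveLeft => -1 | Stay => 0 | MoveRight => 1 end)%R.

(** The view stays centred on the moving head: new cell [z] is old cell [z + offset m], and the
    written symbol sits at old cell 0. *)
Lemma tape_funP t a m z :
  tape_fun (tape_write_move t a m) z =
  if (z + offset m == 0)%R then a else tape_fun t (z + offset m)%R.
Proof.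
case: t => l r; case: m; rewrite /tape_write_move /offset.
- case: z => [[|[|n]]|n].
  + by have ->: (Posz 0 + -1)%R = Negz 0 by []; case: l.
  + by [].
  + have ->: (Posz n.+2 + -1)%R = Posz n.+1 by lia.
    by rewrite /= nth_behead.
  + have ->: (Negz n + -1)%R = Negz n.+1 by lia.
    by rewrite /= nth_behead.
- by rewrite addr0; case: z => [[|n]|n] //=; rewrite nth_behead.
- case: z => [n|[|n]] //.
    have ->: (Posz n + 1)%R = Posz n.+1 by lia.
    by rewrite /= nth_behead.
  by have ->: (Negz n.+1 + 1)%R = Negz n by lia.
Qed.

(** Writing back the scanned symbol only shifts the view; this handles every tape that the
    interpreter merely moves over. *)
Lemma tape_fun_move t a m z : a = tape_fun t 0%R ->
  tape_fun (tape_write_move t a m) z = tape_fun t (z + offset m)%R.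
Proof. by move=> ->; rewrite tape_funP; case: eqP => [->|]. Qed.

Lemma tape_readE t : tape_read t = tape_fun t 0%R.
Proof. by case: t => l [|? ?]. Qed.

(** * Halted configurations and halting bounds *)

Section Halting.

Variable M : turing_machine.

Lemma tm_step_halted (c : config M) : tm_halt c.1 -> tm_step c = c.
Proof. by case: c => q ts /= ->. Qed.

Lemma iter_tm_step_halted n (c : config M) :
  tm_halt c.1 -> iter n (@tm_step M) c = c.
Proof. by move=> H; elim: n => //= n ->; exact: tm_step_halted. Qed.

Lemma iter_halted_leq m n (c : config M) : m <= n ->
  tm_halt (iter m (@tm_step M) c).1 ->
  iter n (@tm_step M) c = iter m (@tm_step M) c.
Proof. by move=> /subnK <- H; rewrite iterD iter_tm_step_halted. Qed.

(** Halted configurations are fixed by [tm_step], so this amounts to being halted after [n] steps;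
    bounds in this form add up. *)
Definition halts_in (n : nat) (c : config M) : Prop :=
  exists2 k, k <= n & tm_halt (iter k (@tm_step M) c).1.

Lemma halts_in_step n c : halts_in n (tm_step c) -> halts_in n.+1 c.
Proof. by case=> k Hk H; exists k.+1; rewrite ?iterSr. Qed.

Lemma halts_in_iter k n c :
  halts_in n (iter k (@tm_step M) c) -> halts_in (n + k) c.
Proof. by case=> l Hl H; exists (l + k); rewrite ?leq_add2r ?iterD. Qed.

Lemma halts_in_leq m n c : m <= n -> halts_in m c -> halts_in n c.
Proof. by move=> mn [k Hk H]; exists k => //; exact: leq_trans mn. Qed.

End Halting.

(** * A machine interpreting straight-line advice programs *)

Definition cont (s : bitseq) : int -> cell := tape_fun ([::], map Some s).

Lemma cont_cons b s z :
  cont (b :: s) z = if (z == 0)%R then Some b else cont s (z - 1)%R.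
Proof.
case: z => [[|n]|n]; first by [].
  by have -> : (Posz n.+1 - 1)%R = Posz n by lia.
have -> : (Negz n - 1)%R = Negz n.+1 by lia.
by rewrite /cont /= !nth_nil.
Qed.

Lemma cont_nil z : cont [::] z = None.
Proof. by case: z => n; rewrite /cont /= nth_nil. Qed.

(** Pushes extend the first argument of the compression by a constant, or by the scanned input or
    witness bit xor [b]; [Mark] extends the second, unary argument; [Run] calls the compression on
    both. *)
Variant instr : Type :=
  Select | Mark | PushC of bool | PushX of bool | PushW of bool
| MoveX of bool | MoveW of bool | Run | Skip.

Definition instr_code (i : instr) : nat :=
  match i with
  | Select => 0 | Mark => 1 | PushC b => 2 + b | PushX b => 4 + b
  | PushW b => 6 + b | MoveX b => 8 + b | MoveW b => 10 + b | Run => 12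
  | Skip => 13
  end.

Definition instr_decode (k : nat) : instr :=
  nth Skip [:: Select; Mark; PushC false; PushC true; PushX false; PushX true;
    PushW false; PushW true; MoveX false; MoveX true; MoveW false; MoveW true;
    Run] k.

Lemma instr_codeK : cancel instr_code instr_decode.
Proof. by do ![case]. Qed.

Lemma instr_code_lt i : instr_code i < 14.
Proof. by case: i => // -[]. Qed.

(* On the advice tape the instruction of code [k] is written [0^k 1], so that
   one bit is consumed per step and a single counter decodes the stream. *)
Definition unary (k : nat) : bitseq := rcons (nseq k false) true.

Definition is_set (c : cell) : bool := c == Some true.

Definition dir (b : bool) : move := if b then MoveRight else MoveLeft.

Definition move_x i : move := if i is MoveX b then dir b else Stay.
Definition move_w i : move :=
  match i with Select => MoveRight | MoveW b => dir b | _ => Stay end.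
Definition pushed0 i (x w : cell) : option bool :=
  match i with
  | PushC b => Some b
  | PushX b => Some (b (+) is_set x)
  | PushW b => Some (b (+) is_set w)
  | _ => None
  end.
Definition pushed1 i : option bool := if i is Mark then Some true else None.

(* A [Select] that reads a clear witness bit disables everything up to the next
   [Select]: this is how the witness chooses a block of the advice. *)
Definition effective (on : bool) (i : instr) : instr :=
  if on then i else if i is Select then i else Skip.

Record mstate : Type := MState {
  ms_on : bool; ms_x : int; ms_w : int; ms_0 : bitseq; ms_1 : bitseq }.

Definition ocons (o : option bool) (s : bitseq) := if o is Some b then b :: s else s.

Definition exec (x w : bitseq) (st : mstate) (i0 : instr) : mstate :=
  let i := effective (ms_on st) i0 in
  MState (if i is Select then is_set (cont w (ms_w st)) else ms_on st)
    (ms_x st + offset (move_x i))%R (ms_w st + offset (move_w i))%R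
    (ocons (pushed0 i (cont x (ms_x st)) (cont w (ms_w st))) (ms_0 st))
    (ocons (pushed1 i) (ms_1 st)).

Lemma horner_leq (p : {poly nat}) m n : m <= n -> p.[m]%R <= p.[n]%R.
Proof.
move=> mn; elim/poly_ind: p => [|p c IH]; first by rewrite !horner0.
by rewrite !hornerD !hornerM !hornerX !hornerC leq_add2r leq_mul.
Qed.

(** * The interpreter and its transition function *)

Section Interpreter.

Variable Mf : turing_machine.
Let K := (tm_tapes Mf).+1.

Variant vm_state : Type :=
  VBuild of bool & 'I_14 | VRun of tm_state Mf | VCompare of 'I_14
| VAccept | VHalt.

Definition vm_state_sum (q : vm_state) :
    (bool * 'I_14) + tm_state Mf + 'I_14 + bool :=
  match q with
  | VBuild b k => inl (inl (inl (b, k)))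
  | VRun q => inl (inl (inr q))
  | VCompare k => inl (inr k)
  | VAccept => inr true
  | VHalt => inr false
  end.

Definition vm_state_of_sum (s : (bool * 'I_14) + tm_state Mf + 'I_14 + bool) :=
  match s with
  | inl (inl (inl (b, k))) => VBuild b k
  | inl (inl (inr q)) => VRun q
  | inl (inr k) => VCompare k
  | inr true => VAccept
  | inr false => VHalt
  end.

Lemma vm_state_sumK : cancel vm_state_sum vm_state_of_sum.
Proof. by case. Qed.

HB.instance Definition _ := Finite.copy vm_state (can_type vm_state_sumK).

(** Input, advice and witness come first; the [K] tapes of the compression machine follow, and its
    two argument tapes are where the strings are built. *)
Definition inp (k : 'I_3) : 'I_(3 + K) := lshift K k.
Definition ix : 'I_(3 + K) := inp (@Ordinal 3 0 isT).
Definition ia : 'I_(3 + K) := inp (@Ordinal 3 1 isT).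
Definition iw : 'I_(3 + K) := inp (@Ordinal 3 2 isT).
Definition sub_tape (j : 'I_K) : 'I_(3 + K) := rshift 3 j.

Definition vm_act (ax aa aw : cell * move) (af : 'I_K -> cell * move) :
    {ffun 'I_(3 + K) -> cell * move} :=
  [ffun i => match split i with
             | inl k => nth ax [:: ax; aa; aw] k
             | inr j => af j
             end].

Lemma vm_actE ax aa aw af :
  [/\ vm_act ax aa aw af ix = ax, vm_act ax aa aw af ia = aa,
      vm_act ax aa aw af iw = aw &
      forall j, vm_act ax aa aw af (sub_tape j) = af j].
Proof.
have E k : split (inp k) = inl k by exact: (unsplitK (inl k)).
by split=> [|||j]; rewrite ffunE ?E // (unsplitK (inr j)).
Qed.

Lemma vm_act_ix ax aa aw af : vm_act ax aa aw af ix = ax.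
Proof. by case: (vm_actE ax aa aw af). Qed.

Definition put (o : option bool) (c : cell) : cell * move :=
  if o is Some b then (Some b, MoveLeft) else (c, Stay).

(** Codes in comparison mode: 2 and 3, the codes of [PushC], expect a bit; 1, the code of [Mark],
    expects a blank and ends the comparison, as do the remaining codes. *)
Definition compared (k : nat) : cell := nth None [:: None; None; Some false; Some true] k.

Definition vm_delta (q : vm_state) (rd : {ffun 'I_(3 + K) -> cell}) :
    vm_state * {ffun 'I_(3 + K) -> cell * move} :=
  let x := rd ix in let a := rd ia in let w := rd iw in
  let f j := rd (sub_tape j) in
  let keep j := (f j, Stay) in
  (* A blank under the head of the first tape makes the output empty. *)
  let reject := (VHalt, vm_act (None, Stay) (a, Stay) (w, Stay) keep) in
  match q with
  | VBuild on k =>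
    match a with
    | None => reject
    | Some false =>
      (* At [k = 13] [inord] falls back to [ord0]; this happens on malformed advice only. *)
      (VBuild on (inord k.+1), vm_act (x, Stay) (a, MoveRight) (w, Stay) keep)
    | Some true =>
      let i := effective on (instr_decode k) in
      if i is Run then
        (* The work heads rest just left of the strings; one move to the right gives the initial
           configuration of [Mf]. *)
        (VRun (tm_start Mf), vm_act (x, Stay) (a, MoveRight) (w, Stay)
           (fun j => (f j, MoveRight)))
      else
        (VBuild (if i is Select then is_set w else on) ord0,
         vm_act (x, move_x i) (a, MoveRight) (w, move_w i)
           (fun j => match nat_of_ord j with
                     | 0 => put (pushed0 i x w) (f j)
                     | 1 => put (pushed1 i) (f j)
                     | _ => keep j
                     end))
    end
  | VRun q =>
    if tm_halt q then
      (VCompare ord0, vm_act (x, Stay) (a, Stay) (w, Stay) keep)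
    else let: (q', act) := tm_delta q [ffun j => f j] in
      (VRun q', vm_act (x, Stay) (a, Stay) (w, Stay) act)
  | VCompare k =>
    match a with
    | None => reject
    | Some false =>
      (VCompare (inord k.+1), vm_act (x, Stay) (a, MoveRight) (w, Stay) keep)
    | Some true =>
      if f ord0 != compared k then reject
      else if compared k is None then
        (* The output takes two steps: the bit is written here, then [VAccept] blanks the cell to
           its right and returns to it. *)
        (VAccept, vm_act (Some true, MoveRight) (a, Stay) (w, Stay) keep)
      else
        (VCompare ord0, vm_act (x, Stay) (a, MoveRight) (w, Stay)
           (fun j => (f j, MoveRight)))
    end
  | VAccept => (VHalt, vm_act (None, MoveLeft) (a, Stay) (w, Stay) keep)
  | VHalt => reject
  end.

Definition vm : turing_machine :=
  @TuringMachine (2 + K) vm_state (VBuild false ord0)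
    (fun q => q == VHalt) vm_delta.

Implicit Types (c : config vm).

(** Cells left of the head are left open, since the advice head never moves back. *)
Definition advice_left c (a : bitseq) : Prop :=
  forall n : nat, tape_fun (c.2 ia) n = nth None (map Some a) n.

Definition vm_read c : {ffun 'I_(3 + K) -> cell} := [ffun i => tape_read (c.2 i)].

Lemma vm_stepE c : ~~ tm_halt c.1 ->
  tm_step c = ((vm_delta c.1 (vm_read c)).1,
    [ffun i => tape_write_move (c.2 i) ((vm_delta c.1 (vm_read c)).2 i).1
                                       ((vm_delta c.1 (vm_read c)).2 i).2]).
Proof.
case: c => q ts /= /negbTE; rewrite /tm_step => ->.
by rewrite /= -/(vm_read (q, ts)); case: vm_delta.
Qed.

Lemma advice_head c a : advice_left c a -> vm_read c ia = head None (map Some a).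
Proof. by move=> /(_ 0); rewrite ffunE tape_readE => ->; rewrite nth0. Qed.

Lemma advice_next t b a m : (forall n : nat, tape_fun t n = nth None (map Some (b :: a)) n) ->
  m = Some b ->
  forall n : nat, tape_fun (tape_write_move t m MoveRight) n = nth None (map Some a) n.
Proof.
move=> E -> n; rewrite tape_fun_move; last by rewrite (E 0).
by have -> : (Posz n + 1)%R = Posz n.+1 by lia.
Qed.

(** * Correctness of building, running and comparing *)

Section Build.

Variables x w : bitseq.

(* While building, the head of a work tape rests on the blank cell just left
   of the string written so far, which grows leftwards. *)
Record builds c (k : 'I_14) (a : bitseq) (st : mstate) : Prop := Builds {
  b_state : c.1 = VBuild (ms_on st) k;
  b_x : tape_fun (c.2 ix) =1 (fun z => cont x (z + ms_x st)%R);
  b_a : advice_left c a;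
  b_w : tape_fun (c.2 iw) =1 (fun z => cont w (z + ms_w st)%R);
  b_sub : forall j, tape_fun (c.2 (sub_tape j)) =1
    (fun z => cont (nth [::] [:: ms_0 st; ms_1 st] j) (z - 1)%R)
}.

Lemma builds_next0 c k a st : builds c k (false :: a) st ->
  builds (tm_step c) (inord k.+1) a st.
Proof.
case=> Eq Ex Ea Ew Ef; rewrite vm_stepE ?Eq //.
have Ra := advice_head Ea; rewrite /= in Ra.
case: (vm_actE (vm_read c ix, Stay) (vm_read c ia, MoveRight)
  (vm_read c iw, Stay) (fun j => (vm_read c (sub_tape j), Stay))) => A1 A2 A3 A4.
have R i : vm_read c i = tape_fun (c.2 i) 0%R by rewrite ffunE tape_readE.
split; rewrite /= Ra //= -Ra.
- by move=> z; rewrite ffunE A1 tape_fun_move ?R //= addr0.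
- by rewrite /advice_left ffunE A2; apply: (advice_next Ea).
- by move=> z; rewrite ffunE A3 tape_fun_move ?R //= addr0.
- by move=> j z; rewrite ffunE A4 tape_fun_move ?R //= addr0 Ef.
Qed.

Lemma put_cont t o s :
  tape_fun t =1 (fun z => cont s (z - 1)%R) ->
  let am := put o (tape_fun t 0%R) in
  tape_fun (tape_write_move t am.1 am.2) =1 (fun z => cont (ocons o s) (z - 1)%R).
Proof.
move=> E am z; rewrite {}/am; case: o => [b|]; last first.
  by rewrite [RHS]/= -E (tape_fun_move Stay) //= addr0.
by rewrite tape_funP /= cont_cons E.
Qed.

Lemma builds_next1 c (k : 'I_14) a st : builds c k (true :: a) st ->
  effective (ms_on st) (instr_decode k) <> Run ->
  builds (tm_step c) ord0 a (exec x w st (instr_decode k)).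
Proof.
case=> Eq Ex Ea Ew Ef NR; rewrite vm_stepE ?Eq //.
have Ra := advice_head Ea; rewrite /= in Ra.
have R i : vm_read c i = tape_fun (c.2 i) 0%R by rewrite ffunE tape_readE.
have Rx : vm_read c ix = cont x (ms_x st) by rewrite R Ex add0r.
have Rw : vm_read c iw = cont w (ms_w st) by rewrite R Ew add0r.
rewrite /exec; set i := effective _ _ in NR *.
set D := vm_delta _ _.
have -> : D = (VBuild (if i is Select then is_set (vm_read c iw) else ms_on st) ord0,
         vm_act (vm_read c ix, move_x i) (vm_read c ia, MoveRight) (vm_read c iw, move_w i)
           (fun j => match nat_of_ord j with
                     | 0 => put (pushed0 i (vm_read c ix) (vm_read c iw)) (vm_read c (sub_tape j))
                     | 1 => put (pushed1 i) (vm_read c (sub_tape j))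
                     | _ => (vm_read c (sub_tape j), Stay)
                     end)).
  by rewrite /D /= Ra -/i; case: (i) NR.
rewrite Rx Rw.
set ff := (fun j : 'I_K => _).
case: (vm_actE (cont x (ms_x st), move_x i) (vm_read c ia, MoveRight)
  (cont w (ms_w st), move_w i) ff) => A1 A2 A3 A4.
split=> //=.
- move=> z; rewrite ffunE A1 /= tape_fun_move -?Rx ?R // Ex.
  by congr cont; rewrite -addrA [(offset _ + _)%R]addrC.
- by rewrite /advice_left ffunE A2; apply: (advice_next Ea).
- move=> z; rewrite ffunE A3 /= tape_fun_move -?Rw ?R // Ew.
  by congr cont; rewrite -addrA [(offset _ + _)%R]addrC.
- move=> j z; rewrite ffunE A4 /ff R; have := Ef j.
  case: (nat_of_ord j) => [|[|j']] /= E; [exact: (put_cont _ E)|exact: (put_cont _ E)|].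
  by rewrite tape_fun_move //= addr0 E.
Qed.


Lemma builds_init a :
  builds (tm_init vm [:: x; a; w]) ord0 a (MState false 0 0 [::] [::]).
Proof.
split=> //=.
- by move=> z; rewrite ffunE addr0.
- by move=> n; rewrite ffunE.
- by move=> z; rewrite ffunE addr0.
- move=> j z; rewrite ffunE /= nth_default //=.
  rewrite -/(cont [::] z) cont_nil.
  by case: (nat_of_ord j) => [|[|j']]; rewrite ?cont_nil //= nth_nil cont_nil.
Qed.

Lemma builds_unary_end c (k : 'I_14) n a st : k + n < 14 ->
  builds c k (unary n ++ a) st ->
  exists m, builds (iter m (@tm_step vm) c) (inord (k + n)) (true :: a) st.
Proof.
elim: n c k => [|n IH] c k Hn B.
  by exists 0; rewrite addn0 inord_val.
have Hk : k.+1 < 14 by lia.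
case: (IH (tm_step c) (inord k.+1)) => //.
- by rewrite inordK // addSnnS.
- exact: builds_next0.
- by move=> m; rewrite inordK // addSnnS -iterSr; exists m.+1.
Qed.

Lemma builds_unary c a st i :
  builds c ord0 (unary (instr_code i) ++ a) st ->
  effective (ms_on st) i <> Run ->
  exists m, builds (iter m (@tm_step vm) c) ord0 a (exec x w st i).
Proof.
case/builds_unary_end => [|m B NR]; first exact: instr_code_lt.
exists m.+1; have dK : instr_decode (inord (0 + instr_code i) : 'I_14) = i.
  by rewrite inordK ?instr_code_lt // instr_codeK.
by rewrite iterS -[in exec _ _ _ i]dK; apply: builds_next1; rewrite ?dK.
Qed.

Definition codes (p : seq instr) : bitseq := flatten [seq unary (instr_code i) | i <- p].

Definition skipped (i : instr) : bool := if i is Select then false else true.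
Definition plain (i : instr) : bool :=
  match i with Select | Run => false | _ => true end.

Lemma codes_cons i p : codes (i :: p) = unary (instr_code i) ++ codes p.
Proof. by []. Qed.

Lemma codes_cat p p' : codes (p ++ p') = codes p ++ codes p'.
Proof. by rewrite /codes map_cat flatten_cat. Qed.

Lemma exec_skipped st i : ~~ ms_on st -> skipped i -> exec x w st i = st.
Proof. by case: st => -[] px pw s0 s1 //; case: i => //= *; rewrite /exec /= !addr0. Qed.

Lemma builds_skipped c a st p : ~~ ms_on st -> all skipped p ->
  builds c ord0 (codes p ++ a) st ->
  exists m, builds (iter m (@tm_step vm) c) ord0 a st.
Proof.
move=> off; elim: p c => [|i p IH] c /=; first by exists 0.
case/andP=> Hi His; rewrite codes_cons -catA => B.
case: (builds_unary B); first by move/negbTE: off => ->; case: (i) Hi.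
rewrite exec_skipped // => m /(IH _ His) [m' B'].
by exists (m' + m); rewrite iterD.
Qed.

Lemma exec_on st i : plain i -> ms_on st -> ms_on (exec x w st i).
Proof. by case: st => -[] // px pw s0 s1; case: i. Qed.

Lemma foldl_exec_on st p : all plain p -> ms_on st ->
  ms_on (foldl (exec x w) st p).
Proof. by elim: p st => //= i p IH st /andP[Hi Hp] /(exec_on Hi); exact: IH. Qed.

Lemma builds_plain c a st p : ms_on st -> all plain p ->
  builds c ord0 (codes p ++ a) st ->
  exists m, builds (iter m (@tm_step vm) c) ord0 a (foldl (exec x w) st p).
Proof.
elim: p c st => [|i p IH] c st on /=; first by exists 0.
case/andP=> Hi His; rewrite codes_cons -catA => B.
case: (builds_unary B); first by rewrite on; case: (i) Hi.
move=> m /(IH _ _ (exec_on Hi on) His) [m' B'].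
by exists (m' + m); rewrite iterD.
Qed.

(** Tapes are compared cell by cell because their list representations may differ in trailing
    blanks. *)
Record runs c (a : bitseq) (d : config Mf) : Prop := Runs {
  r_state : c.1 = VRun d.1;
  r_a : advice_left c a;
  r_sub : forall j, tape_fun (c.2 (sub_tape j)) =1 tape_fun (d.2 j)
}.

Record compares c (k : 'I_14) (a : bitseq) (t : tape) : Prop := Compares {
  c_state : c.1 = VCompare k;
  c_a : advice_left c a;
  c_sub : tape_fun (c.2 (sub_tape ord0)) =1 tape_fun t
}.

Lemma runs_start c (k : 'I_14) a st : builds c k (true :: a) st ->
  ms_on st -> instr_decode k = Run ->
  runs (tm_step c) a (tm_init Mf [:: ms_0 st; ms_1 st]).
Proof.
case=> Eq Ex Ea Ew Ef on Ek; rewrite vm_stepE ?Eq //.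
have Ra := advice_head Ea; rewrite /= in Ra.
have R i : vm_read c i = tape_fun (c.2 i) 0%R by rewrite ffunE tape_readE.
case: (vm_actE (vm_read c ix, Stay) (vm_read c ia, MoveRight)
  (vm_read c iw, Stay) (fun j => (vm_read c (sub_tape j), MoveRight))) => A1 A2 A3 A4.
split; rewrite /= Ra /= Ek /= on //= -Ra.
- by rewrite /advice_left ffunE A2; apply: (advice_next Ea).
- by move=> j z; rewrite ffunE A4 tape_fun_move ?R //= Ef addrK ffunE.
Qed.

Lemma runs_step c a d : runs c a d -> ~~ tm_halt d.1 ->
  runs (tm_step c) a (tm_step d).
Proof.
case: d => q ts; case=> Eq Ea Ef NH; rewrite vm_stepE ?Eq //.
have R i : vm_read c i = tape_fun (c.2 i) 0%R by rewrite ffunE tape_readE.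
rewrite /tm_step /= (negbTE NH).
have <- : [ffun j => vm_read c (sub_tape j)] = [ffun i => tape_read (ts i)].
  by apply/ffunP => j; rewrite !ffunE !tape_readE Ef.
case: tm_delta => q' act /=.
case: (vm_actE (vm_read c ix, Stay) (vm_read c ia, Stay)
  (vm_read c iw, Stay) act) => A1 A2 A3 A4.
split => //=.
- by rewrite /advice_left ffunE A2 => n; rewrite (tape_fun_move Stay) ?R // addr0.
- by move=> j z; rewrite ffunE A4 [in RHS]ffunE !tape_funP Ef.
Qed.

Lemma runs_stop c a d : runs c a d -> tm_halt d.1 ->
  compares (tm_step c) ord0 a (d.2 ord0).
Proof.
case: d => q ts; case=> Eq Ea Ef H; rewrite vm_stepE ?Eq //.
have R i : vm_read c i = tape_fun (c.2 i) 0%R by rewrite ffunE tape_readE.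
case: (vm_actE (vm_read c ix, Stay) (vm_read c ia, Stay)
  (vm_read c iw, Stay) (fun j => (vm_read c (sub_tape j), Stay))) => A1 A2 A3 A4.
split; rewrite /= H //=.
- by rewrite /advice_left ffunE A2 => n; rewrite (tape_fun_move Stay) ?R // addr0.
- by move=> z; rewrite ffunE A4 tape_fun_move ?R //= addr0 Ef.
Qed.

(** The extra step leaves the simulation; if [d] halts early, the rest of its iteration is idle. *)
Lemma runs_iter n c a d : runs c a d -> tm_halt (iter n (@tm_step Mf) d).1 ->
  exists2 m, m <= n.+1 &
    compares (iter m (@tm_step vm) c) ord0 a ((iter n (@tm_step Mf) d).2 ord0).
Proof.
elim: n c d => [|n IH] c d Rn H; first by exists 1 => //; exact: runs_stop.
case: (boolP (tm_halt d.1)) => Hd.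
  by exists 1; rewrite ?(iter_tm_step_halted n.+1 Hd) //; exact: (runs_stop Rn Hd).
rewrite iterSr in H *; case: (IH _ _ (runs_step Rn Hd) H) => m Hm Cm.
by exists m.+1; rewrite // iterSr.
Qed.

Definition outcome c (b : bool) : Prop :=
  exists n, let d := iter n (@tm_step vm) c in
    tm_halt d.1 /\ tm_output d = if b then [:: true] else [::].

Lemma outcome_iter n c b : outcome (iter n (@tm_step vm) c) b -> outcome c b.
Proof. by case=> m; rewrite -iterD; exists (m + n). Qed.

Lemma outcome_step c b : outcome (tm_step c) b -> outcome c b.
Proof. exact: (@outcome_iter 1). Qed.

Lemma ixE : ix = ord0 :> 'I_(tm_tapes vm).+1.
Proof. exact: val_inj. Qed.

Lemma rejected c act : ~~ tm_halt c.1 -> vm_delta c.1 (vm_read c) = (VHalt, act) ->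
  act ix = (None, Stay) ->
  tm_halt (tm_step c).1 /\ outcome c false.
Proof.
move=> NH E A; suff [H O] : tm_halt (tm_step c).1 /\ tm_output (tm_step c) = [::].
  by split=> //; exists 1.
rewrite vm_stepE // E /=; split=> //.
by rewrite /tm_output /= ffunE -ixE A; case: (c.2 ix).
Qed.

Lemma accepted c : c.1 = VAccept ->
  (exists l, (c.2 ix).1 = Some true :: l) ->
  tm_halt (tm_step c).1 /\ outcome c true.
Proof.
move=> Eq [l El]; suff [H O] : tm_halt (tm_step c).1 /\ tm_output (tm_step c) = [:: true].
  by split=> //; exists 1.
rewrite vm_stepE ?Eq //=; split=> //.
case: (vm_actE (None, MoveLeft) (vm_read c ia, Stay)
  (vm_read c iw, Stay) (fun j => (vm_read c (sub_tape j), Stay))) => A1 A2 A3 A4.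
rewrite /tm_output /= ffunE -ixE A1 /=.
by case: (c.2 ix) El => l' r' /= ->.
Qed.


Lemma compares_next0 c k a t : compares c k (false :: a) t ->
  compares (tm_step c) (inord k.+1) a t.
Proof.
case=> Eq Ea Ef; rewrite vm_stepE ?Eq //.
have Ra := advice_head Ea; rewrite /= in Ra.
have R i : vm_read c i = tape_fun (c.2 i) 0%R by rewrite ffunE tape_readE.
case: (vm_actE (vm_read c ix, Stay) (vm_read c ia, MoveRight)
  (vm_read c iw, Stay) (fun j => (vm_read c (sub_tape j), Stay))) => A1 A2 A3 A4.
split; rewrite /= Ra //= -Ra.
- by rewrite /advice_left ffunE A2; apply: (advice_next Ea).
- by move=> z; rewrite ffunE A4 tape_fun_move ?R //= addr0 Ef.
Qed.

Lemma compares_nil c k t : compares c k [::] t ->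
  tm_halt (tm_step c).1 /\ outcome c false.
Proof.
case=> Eq Ea Ef; apply: rejected; rewrite ?Eq //=.
  by rewrite (advice_head Ea).
exact: vm_act_ix.
Qed.

Lemma compares_next1 c (k : 'I_14) a t : compares c k (true :: a) t ->
  if tape_read t != compared k then tm_halt (tm_step c).1 /\ outcome c false
  else if compared k is None then tm_halt (tm_step (tm_step c)).1 /\ outcome c true
  else compares (tm_step c) ord0 a (tape_write_move t (tape_read t) MoveRight).
Proof.
case=> Eq Ea Ef.
have Ra := advice_head Ea; rewrite /= in Ra.
have R i : vm_read c i = tape_fun (c.2 i) 0%R by rewrite ffunE tape_readE.
have Rf : vm_read c (sub_tape ord0) = tape_read t by rewrite R tape_readE Ef.
case: ifP => Hk.
  apply: rejected; rewrite ?Eq //=; first by rewrite Ra Rf Hk.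
  exact: vm_act_ix.
case Ek: (compared k) => [b|].
  case: (vm_actE (vm_read c ix, Stay) (vm_read c ia, MoveRight)
    (vm_read c iw, Stay) (fun j => (vm_read c (sub_tape j), MoveRight))) => A1 A2 A3 A4.
  rewrite vm_stepE ?Eq //; split; rewrite /= Ra Rf Hk Ek //= -Ra.
  - by rewrite /advice_left ffunE A2; apply: (advice_next Ea).
  - by move=> z; rewrite ffunE A4 /= Rf !tape_funP Ef.
suff [H /outcome_step O] : tm_halt (tm_step (tm_step c)).1 /\ outcome (tm_step c) true by split.
apply: accepted; rewrite vm_stepE ?Eq //= Ra Rf Hk Ek //= ffunE vm_act_ix /=.
by case: (c.2 ix) => l r; exists l.
Qed.

Lemma compares_unary c (k : 'I_14) n a t : k + n < 14 ->
  compares c k (unary n ++ a) t ->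
  exists m, compares (iter m (@tm_step vm) c) (inord (k + n)) (true :: a) t.
Proof.
elim: n c k => [|n IH] c k Hn C.
  by exists 0; rewrite addn0 inord_val.
have Hk : k.+1 < 14 by lia.
case: (IH (tm_step c) (inord k.+1)) => //.
- by rewrite inordK // addSnnS.
- exact: compares_next0.
- by move=> m; rewrite inordK // addSnnS -iterSr; exists m.+1.
Qed.

(* After [Run] the same codes are reinterpreted: [PushC b] checks that the next
   output bit is [b], and [Mark] checks that the output is over. *)
Definition comparison (y : bitseq) : seq instr := rcons (map PushC y) Mark.

(** Every comparison ends in acceptance or rejection, so a run executes at most one block, whatever
    advice [a] follows. *)
Lemma compares_outcome c a y t : compares c ord0 (codes (comparison y) ++ a) t ->
  outcome c (bits_upto_blank t.2 == y).
Proof.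
elim: y c t => [|b y IH] c t; rewrite codes_cons -catA.
  case/compares_unary => // m /compares_next1.
  rewrite inordK //= /tape_read; case: t => l [|[b|] r] /= C; last by
    case: C => _ /outcome_iter.
    by case: C => _ /outcome_iter.
  by case: C => _ /outcome_iter.
case/compares_unary => [|m /compares_next1]; first by case: (b).
rewrite inordK ?instr_code_lt //=.
have -> : compared (0 + (2 + b)) = Some b by case: (b).
rewrite /tape_read; case: t => l [|[b'|] r] /=.
- by case=> _ /outcome_iter.
- rewrite (inj_eq Some_inj) eqseq_cons; case: eqP => [->|_] /=.
    by move/IH => /(@outcome_step _ _) /outcome_iter.
  by case=> _ /outcome_iter.
- by case=> _ /outcome_iter.
Qed.

(** Each step consumes an advice bit or leads to a halt within two steps. *)
Lemma compares_halts c k a t : compares c k a t -> halts_in (size a).+2 c.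
Proof.
elim: a c k t => [|[] a IH] c k t C.
- by case: (compares_nil C) => H _; exists 1.
- have := compares_next1 C; case: ifP => _; first by case=> H _; exists 1.
  case: (compared k) => [b|]; first by move/IH; exact: halts_in_step.
  by case=> H _; exists 2.
- by apply: halts_in_step; apply: IH (compares_next0 C).
Qed.

Lemma builds_nil c k st : builds c k [::] st ->
  tm_halt (tm_step c).1 /\ outcome c false.
Proof.
case=> Eq _ Ea _ _; apply: rejected; rewrite ?Eq //=.
  by rewrite (advice_head Ea).
exact: vm_act_ix.
Qed.

Section Correct.

Variables (f : 2.-tuple bitseq -> bitseq) (pf : {poly nat}).
Hypothesis Mf_f : forall xs : 2.-tuple bitseq,
  computes_within Mf pf.[sumn (map size xs)]%R xs (f xs).

Lemma exec_size st i :
  size (ms_0 (exec x w st i)) + size (ms_1 (exec x w st i)) <=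
  size (ms_0 st) + size (ms_1 st) + 2.
Proof.
rewrite /exec /=.
have H o s : size (ocons o s) <= (size s).+1 by case: o => //=.
by have := H (pushed0 (effective (ms_on st) i) (cont x (ms_x st)) (cont w (ms_w st))) (ms_0 st);
  have := H (pushed1 (effective (ms_on st) i)) (ms_1 st); lia.
Qed.

(** Each advice bit costs one step and adds at most two bits to the strings, whose total length is
    thus at most [N] when [Mf] starts. The advice is arbitrary, as [poly_time] demands. *)
Lemma builds_halts N c k a st : builds c k a st ->
  size (ms_0 st) + size (ms_1 st) + 2 * size a <= N ->
  halts_in (size a + pf.[N]%R).+3 c.
Proof.
elim: a c k st => [|[] a IH] c k st B HN.
- by case: (builds_nil B) => H _; exists 1.
- have [NR|[on Rk]] : effective (ms_on st) (instr_decode k) <> Run \/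
      ms_on st /\ instr_decode k = Run.
  + by case: (ms_on st) (instr_decode k) => -[]; (try by left); right.
  + apply: halts_in_step; apply: IH (builds_next1 B NR) _.
    by have := exec_size st (instr_decode k); move: HN => /=; lia.
  + have [H _] := Mf_f [tuple ms_0 st; ms_1 st].
    case: (runs_iter (runs_start B on Rk) H) => m Hm /compares_halts.
    move/halts_in_iter/halts_in_step; apply: halts_in_leq.
    have : pf.[sumn (map size [tuple ms_0 st; ms_1 st])]%R <= pf.[N]%R.
      by apply: horner_leq => /=; move: HN => /=; lia.
    by move: Hm => /=; lia.
- apply: halts_in_step; apply: IH (builds_next0 B) _.
  by move: HN => /=; lia.
Qed.

Definition block (b : seq instr * bitseq) : seq instr :=
  Select :: b.1 ++ Run :: comparison b.2.

(* The block that is run is the one whose index is the position of the first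
   set bit of [w]. *)
Fixpoint accepts (bs : seq (seq instr * bitseq)) (pw : int) : bool :=
  if bs is b :: bs' then
    if is_set (cont w pw) then
      let st := foldl (exec x w) (MState true 0 (pw + 1)%R [::] [::]) b.1 in
      f [tuple ms_0 st; ms_1 st] == b.2
    else accepts bs' (pw + 1)%R
  else false.

Lemma builds_accepts c bs pw :
  all (fun b => all plain b.1) bs ->
  builds c ord0 (codes (flatten (map block bs))) (MState false 0 pw [::] [::]) ->
  outcome c (accepts bs pw).
Proof.
elim: bs c pw => [|[p y] bs IH] c pw /=.
  by move=> _ /builds_nil [].
case/andP=> Hp Hbs; rewrite codes_cons => /(@builds_unary _ _ _ Select).
case=> // m; rewrite /exec /= !addr0 codes_cat => B.
apply: (@outcome_iter m); case: ifP B => _ B; last first.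
  (* The bit is clear: the rest of the block contains no [Select], so all of it is skipped and the
     next block reads the next bit. *)
  have [|m1 B1] := builds_skipped (isT : ~~ ms_on (MState false _ _ _ _)) _ B.
    rewrite all_cat /= all_rcons /= all_map (sub_all _ Hp) ?(eq_all (a2 := predT)) ?all_predT //.
    by case.
  by apply: (@outcome_iter m1); apply: IH.
rewrite codes_cat -catA codes_cons -catA in B.
have [m1 B1] := builds_plain (isT : ms_on (MState true _ _ _ _)) Hp B.
have := foldl_exec_on Hp (isT : ms_on (MState true 0 (pw + 1)%R [::] [::])).
set st := foldl _ _ _ in B1 * => on.
have [//|m2 B2] := builds_unary_end _ B1.
have Rk : instr_decode (inord (0 + instr_code Run) : 'I_14) = Run.
  by rewrite inordK.
have [H E] := Mf_f [tuple ms_0 st; ms_1 st].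
case: (runs_iter (runs_start B2 on Rk) H) => m3 _ /compares_outcome.
rewrite -E => /outcome_iter/outcome_step/outcome_iter/outcome_iter O.
exact: O.
Qed.

End Correct.

End Build.

(** * The interpreter as a polynomial-time verifier *)

Section Verifier.

Variables (f : 2.-tuple bitseq -> bitseq) (pf : {poly nat}).
Hypothesis Mf_f : forall xs : 2.-tuple bitseq,
  computes_within Mf pf.[sumn (map size xs)]%R xs (f xs).

(** The two strings built have total length at most [2 * n]; the term [n + 3] pays for reading the
    advice and changing phases. *)
Definition vm_time : {poly nat} := (pf \Po ('X *+ 2) + 'X + 3%:P)%R.

Lemma vm_timeE n : vm_time.[n]%R = pf.[(2 * n)%N]%R + n + 3.
Proof.
rewrite /vm_time !hornerD hornerX hornerC horner_comp hornerMn hornerX.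
by have -> : (n *+ 2)%R = 2 * n by rewrite mulr2n mul2n -addnn.
Qed.

Definition vm_output (xs : 3.-tuple bitseq) : bitseq :=
  tm_output (iter vm_time.[sumn (map size xs)]%R (@tm_step vm) (tm_init vm xs)).

Lemma vm_halts (xs : 3.-tuple bitseq) :
  tm_halt (iter vm_time.[sumn (map size xs)]%R (@tm_step vm) (tm_init vm xs)).1.
Proof.
case: xs => -[|x [|a [|w []]]] // Hs; rewrite /= vm_timeE.
have [|k Hk H] := builds_halts Mf_f (N := 2 * (size x + (size a + (size w + 0))))
    (builds_init x w a).
  by rewrite /=; lia.
rewrite (iter_halted_leq _ H) //; lia.
Qed.

Lemma vm_poly_time : poly_time vm_output.
Proof. by exists vm, vm_time => xs; split=> //; exact: vm_halts. Qed.

Lemma vm_outputP x w bs : all (fun b => all plain b.1) bs ->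
  vm_output [tuple x; codes (flatten (map block bs)); w] = [:: true] <->
  accepts x w f bs 0.
Proof.
move=> Hbs; set a := codes _.
have [n [H E]] := builds_accepts Mf_f Hbs (builds_init x w a).
rewrite /vm_output; set N := horner _ _; set c := tm_init _ _ in H E *.
have -> : iter N (@tm_step vm) c = iter n (@tm_step vm) c.
  have HN := vm_halts [tuple x; a; w]; rewrite -/N -/c in HN.
  by case: (leqP n N) => L; [|symmetry]; apply: iter_halted_leq => //; exact: ltnW.
by rewrite E; case: accepts.
Qed.

End Verifier.

End Interpreter.

(** * From hitting set to offensive alliance *)

(* [(c, None)] is the constant [c], and [(c, Some b)] is the bit [b] xor [c]. *)
Definition entry (B : Type) : Type := (bool * option B)%type.

Definition entry_val (B : Type) (beta : B -> bool) (x : entry B) : bool :=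
  x.1 (+) (if x.2 is Some b then beta b else false).

(** * Degrees and vertex covers *)

Section GraphFacts.

Variables (T : finType) (e : rel T).

(** The degree splits over [S] and its complement, so the alliance condition asks for a strict
    majority of neighbours in [S]. *)
Lemma deg_in_setC (S : {set T}) v :
  (deg_in e (~: S) v + 1 <= deg_in e S v) = (#|[set u | e v u]| < 2 * deg_in e S v).
Proof.
have -> : #|[set u | e v u]| = deg_in e S v + deg_in e (~: S) v.
  rewrite -(cardsID S); congr (_ + _); apply: eq_card => u; rewrite !inE andbC //.
lia.
Qed.

Lemma deg_in_leq (S : {set T}) v : deg_in e S v <= #|S|.
Proof. by apply: subset_leq_card; apply/subsetP => u; rewrite inE; case/andP. Qed.

Lemma open_nbhI (S : {set T}) u v : u \in S -> e u v -> v \notin S ->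
  v \in open_nbh e S.
Proof. by move=> uS uv vS; rewrite inE vS; apply/existsP; exists u; rewrite uS. Qed.

(** The edges from [v] to [g v] match [C] with vertices outside it; any cover [D] contains an end of
    each, which [h] picks. *)
Lemma vertex_cover_number_eq (C : {set T}) (g : T -> T) : vertex_cover e C ->
  (forall v, v \in C -> e v (g v)) -> (forall v, v \in C -> g v \notin C) ->
  {in C &, injective g} ->
  vertex_cover_number e = #|C|.
Proof.
move=> vcC eg gC inj_g; rewrite /vertex_cover_number.
case: arg_minnP => [|D vcD minD].
  by apply/forallP => u; apply/forallP => v; rewrite inE implybT.
apply/eqP; rewrite eqn_leq minD //=.
pose h v := if v \in D then v else g v.
have inj_h : {in C &, injective h}.
  move=> v v' Cv Cv'; rewrite /h; case: ifP => Dv; case: ifP => Dv' //.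
  - by move=> E; have := gC _ Cv'; rewrite -E Cv.
  - by move=> E; have := gC _ Cv; rewrite E Cv'.
  - exact: inj_g.
rewrite -(card_in_imset inj_h); apply: subset_leq_card.
apply/subsetP => _ /imsetP[v Cv ->]; rewrite /h; case: ifP => // Dv.
have /forallP/(_ v)/forallP/(_ (g v)) := vcD.
by rewrite eg // Dv.
Qed.

End GraphFacts.

(** * Invariance under graph isomorphism *)

Section GraphIso.

Variables (T T' : finType) (e : rel T) (e' : rel T') (f : T -> T').
Hypothesis f_bij : bijective f.
Hypothesis fe : forall u v, e' (f u) (f v) = e u v.

Let f_inj : injective f. Proof. exact: bij_inj. Qed.

Lemma iso_deg_in (S : {set T}) v : deg_in e' (f @: S) (f v) = deg_in e S v.
Proof.
rewrite /deg_in -(card_imset _ f_inj); apply: eq_card => u'.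
case: f_bij => g fK gK; rewrite -(gK u') inE !mem_imset // inE fe //.
Qed.

Lemma iso_setC (S : {set T}) : ~: (f @: S) = f @: (~: S).
Proof.
case: f_bij => g fK gK; apply/setP => u'.
by rewrite -(gK u') inE !mem_imset // inE.
Qed.

Lemma iso_open_nbh (S : {set T}) v : (f v \in open_nbh e' (f @: S)) = (v \in open_nbh e S).
Proof.
rewrite !inE mem_imset //; congr (_ && _); apply/existsP/existsP.
  by case=> _ /andP[/imsetP[u uS ->]]; rewrite fe => E; exists u; rewrite uS.
by case=> u /andP[uS E]; exists (f u); rewrite mem_imset // uS fe.
Qed.

Lemma iso_offensive_alliance (S : {set T}) :
  offensive_alliance e' (f @: S) = offensive_alliance e S.
Proof.
rewrite /offensive_alliance; congr (_ && _).
  by rewrite -!card_gt0 card_imset.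
apply/forall_inP/forall_inP => H v.
  by rewrite -iso_open_nbh => /H; rewrite iso_setC !iso_deg_in.
case: f_bij => g fK gK; rewrite -(gK v) iso_open_nbh => /H.
by rewrite iso_setC !iso_deg_in.
Qed.

Lemma iso_vertex_cover (C : {set T}) : vertex_cover e' (f @: C) = vertex_cover e C.
Proof.
apply/forallP/forallP => H u; apply/forallP => v; apply/implyP.
  by rewrite -fe => uv; have := forallP (H (f u)) (f v); rewrite uv !mem_imset.
case: f_bij => g fK gK; rewrite -(gK u) -(gK v) fe => uv.
by have := forallP (H (g u)) (g v); rewrite uv !mem_imset.
Qed.

Lemma iso_preimset (S : {set T'}) : f @: (f @^-1: S) = S.
Proof.
by case: f_bij => g fK gK; apply/setP => y; rewrite -(gK y) mem_imset // inE.
Qed.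

Lemma iso_vertex_cover_number : vertex_cover_number e' = vertex_cover_number e.
Proof.
rewrite /vertex_cover_number.
have vcT (Q : finType) (r : rel Q) : vertex_cover r [set: Q].
  by apply/forallP => u; apply/forallP => v; rewrite inE implybT.
case: arg_minnP => // C' vC' minC'; case: arg_minnP => // C vC minC.
apply/eqP; rewrite eqn_leq -{1}(card_imset C f_inj) minC' ?iso_vertex_cover //=.
by rewrite -(iso_preimset C') card_imset // minC // -iso_vertex_cover iso_preimset.
Qed.

Lemma iso_alliance r :
  (exists S, offensive_alliance e' S /\ 1 <= #|S| <= r) <->
  (exists S, offensive_alliance e S /\ 1 <= #|S| <= r).
Proof.
split=> -[S [oS cS]].
  exists (f @^-1: S); rewrite -iso_offensive_alliance -(card_imset _ f_inj).
  by rewrite iso_preimset.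
by exists (f @: S); rewrite iso_offensive_alliance card_imset.
Qed.

End GraphIso.

(** * The graph of a hitting set instance *)

Section HittingSet.

Variables (U Chk : finType) (k : nat).

(* The core is made of a clique of [#|U|] base vertices, the elements of [U],
   and a clique of false vertices, one more than an alliance may contain.  The
   leaves make every core vertex too heavy to be outside an alliance that it
   is adjacent to, and force the vertex cover number to be the size of the
   core whatever [K] is.  A check has degree [2 * #|U| + 1]: all of the base, a
   false twin for each element that it does not contain, and one more false
   vertex; hence, given the base, what it needs is one of its elements. *)
Definition alliance_size : nat := #|U| + k.
Definition core : finType := ((U + U) + (option U + 'I_k))%type.
Definition vertex : finType := (core + Chk + core * 'I_(2 * alliance_size))%type.

Definition coreB (e : U) : core := inl (inl e).
Definition coreU (e : U) : core := inl (inr e).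
Definition coreF (f : option U + 'I_k) : core := inr f.
Definition vA (a : core) : vertex := inl (inl a).
Definition vC (c : Chk) : vertex := inl (inr c).
Definition vL (a : core) i : vertex := inr (a, i).

Definition core_adj (a b : core) : bool :=
  match a, b with
  | inl (inl e), inl (inl e') => e != e'
  | inr f, inr f' => f != f'
  | _, _ => false
  end.

Definition core_check (a : core) (c : Chk) : entry (Chk * U) :=
  match a with
  | inl (inl _) => (true, None)
  | inl (inr e) => (false, Some (c, e))
  | inr (inl (Some e)) => (true, Some (c, e))
  | inr (inl None) => (true, None)
  | inr (inr _) => (false, None)
  end.

(** Adjacency is kept symbolic so that each bit of the encoded graph is a constant or a possibly
    negated incidence bit. *)
Definition adj_entry (v w : vertex) : entry (Chk * U) :=
  match v, w with
  | inl (inl a), inl (inl b) => (core_adj a b, None)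
  | inl (inl a), inl (inr c) => core_check a c
  | inl (inr c), inl (inl a) => core_check a c
  | inl (inl a), inr (b, _) => (a == b, None)
  | inr (b, _), inl (inl a) => (a == b, None)
  | _, _ => (false, None)
  end.

Variable K : Chk * U -> bool.

Definition adj : rel vertex := fun v w => entry_val K (adj_entry v w).

Lemma adj_sym : symmetric adj.
Proof.
by move=> [[a|c]|[a i]] [[b|d]|[b j]] //; case: a => -[a|a]; case: b => -[b|b] //=;
  rewrite /adj /entry_val /= eq_sym.
Qed.

Lemma adj_irr : irreflexive adj.
Proof.
by move=> [[a|c]|[a i]] //; case: a => -[a|a] //=; rewrite /adj /entry_val /= eqxx.
Qed.

Lemma adj_leaf a i v : adj (vL a i) v = (v == vA a).
Proof.
case: v => [[b|c]|[b j]] //; rewrite /adj /entry_val /= addbF.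
by apply/eqP/eqP => [->|[->]].
Qed.

(** The core covers every edge, and matching each core vertex with one of its leaves shows that it
    is a minimum cover. *)
Lemma vertex_cover_number_adj : 0 < alliance_size ->
  vertex_cover_number adj = 3 * #|U| + k + 1.
Proof.
move=> r0; have L0 : 0 < 2 * alliance_size by rewrite muln_gt0.
pose C := [set v : vertex | if v is inl (inl _) then true else false].
pose g v := if v is inl (inl a) then vL a (Ordinal L0) else v.
rewrite (@vertex_cover_number_eq _ _ C g).
- have -> : C = vA @: [set: core].
    apply/setP => -[[a|c]|[a i]]; rewrite inE /=; symmetry.
    + by rewrite mem_imset ?inE // => ? ? [].
    + by apply/imsetP => -[? _].
    + by apply/imsetP => -[? _].
  rewrite card_imset ?cardsT => [|? ? [] //].
  by rewrite !card_sum card_option card_ord; lia.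
- apply/forallP => v; apply/forallP => w; rewrite !inE; apply/implyP.
  by case: v w => [[a|c]|[a i]] [[b|d]|[b j]].
- by move=> [[a|c]|[a i]]; rewrite inE //= => _; rewrite adj_sym adj_leaf.
- by move=> [[a|c]|[a i]]; rewrite !inE.
- by move=> [[a|c]|[a i]] [[b|d]|[b j]]; rewrite !inE //= => _ _ [->].
Qed.

Local Notation vB := (fun e => vA (coreB e)).
Local Notation vU := (fun e => vA (coreU e)).
Local Notation vF := (fun f => vA (coreF f)).

(** For each [e], exactly one of the element vertex and its false twin is a neighbour, so [K] does
    not affect the degree. *)
Lemma deg_check c : #|[set v | adj (vC c) v]| = 2 * #|U| + 1.
Proof.
pose g (x : U + option U) : vertex :=
  match x with
  | inl e => vB e
  | inr (Some e) => if K (c, e) then vU e else vF (inl (Some e))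
  | inr None => vF (inl None)
  end.
have inj_g : injective g.
  rewrite /g /vA /coreB /coreU /coreF => -[e|[e|]] [e'|[e'|]] //=;
    do ?[case: ifP => _]; by case=> // ->.
have -> : [set v | adj (vC c) v] = g @: [set: U + option U].
  apply/setP => v; rewrite inE; apply/idP/imsetP => [|[x _ ->]]; last first.
    by case: x => [e|[e|]] //=; case: ifP => Kc; rewrite /adj /entry_val /= Kc.
  case: v => [[[[e|e]|[[e|]|i]]|d]|[a i]] //; rewrite /adj /entry_val /= => Kc.
  - by exists (inl e); rewrite ?inE.
  - by exists (inr (Some e)); rewrite ?inE //= Kc.
  - by exists (inr (Some e)); rewrite ?inE //= ifN // -addTb.
  - by exists (inr None); rewrite ?inE.
rewrite card_imset // cardsT card_sum card_option; lia.
Qed.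

Definition hitting (H : {set U}) : Prop := forall c, exists2 e, e \in H & K (c, e).

(** A core vertex has [2 * alliance_size] leaves, so no set of at most [alliance_size] vertices
    holds a strict majority of its neighbours. *)
Lemma heavy (S : {set vertex}) a : #|S| <= alliance_size ->
  offensive_alliance adj S ->
  (exists2 u, u \in S & adj u (vA a)) -> vA a \in S.
Proof.
move=> cS /andP[_ /forall_inP oS] [u uS ua]; apply/negPn/negP => aS.
have := oS _ (open_nbhI uS ua aS); rewrite deg_in_setC.
have : 2 * alliance_size <= #|[set w | adj (vA a) w]|.
  rewrite -{1}(card_ord (2 * alliance_size)) -cardsT.
  rewrite -(card_imset _ (_ : injective (fun i => vL a i))); last by move=> ? ? [].
  apply: subset_leq_card; apply/subsetP => _ /imsetP[i _ ->].
  by rewrite inE adj_sym adj_leaf.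
have := deg_in_leq adj S (vA a); lia.
Qed.

(** The alliance is the base with the element vertices of [H]. A check sees the base and an element
    of [H], a strict majority of its [2 * #|U| + 1] neighbours; a leaf has a single neighbour; no
    core vertex outside is adjacent. *)
Lemma alliance_of_hitting (H : {set U}) : 0 < #|U| -> #|H| <= k -> hitting H ->
  exists S, offensive_alliance adj S /\ 1 <= #|S| <= alliance_size.
Proof.
move=> U0 kH hH; case/card_gt0P: (U0) => e0 _.
pose g (x : U + U) : vertex := match x with inl e => vB e | inr e => vU e end.
have inj_g : injective g by move=> [e|e] [e'|e'] // [->].
pose S := g @: [set x | if x is inr e then e \in H else true].
have SB e : vB e \in S by apply/imsetP; exists (inl e); rewrite ?inE.
have SU e : (vU e \in S) = (e \in H).
  by rewrite -[vU e]/(g (inr e)) mem_imset // inE.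
have Sg v : v \in S -> exists x, v = g x by case/imsetP => x _ ->; exists x.
have cS : #|S| = #|U| + #|H|.
  rewrite card_imset //.
  have -> : [set x : U + U | if x is inr e then e \in H else true] =
    inl @: [set: U] :|: inr @: H.
    apply/setP => -[e|e]; rewrite !inE.
      by rewrite (mem_imset _ _ (@inl_inj _ _)) inE.
    rewrite (mem_imset _ _ (@inr_inj _ _)) orbC; case: (e \in H) => //=.
    by symmetry; apply/negbTE/imsetP => -[].
  rewrite cardsU !card_imset ?cardsT; [|exact: inr_inj|exact: inl_inj].
  rewrite (_ : _ :&: _ = set0) ?cards0 ?subn0 //.
  by apply/setP => -[e|e]; rewrite !inE; apply/andP => -[] /imsetP[? _ //] ?  /imsetP[? _ //].
exists S; split; last by rewrite cS /alliance_size leq_add2l kH addn_gt0 U0.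
apply/andP; split; first by apply/set0Pn; exists (vB e0).
apply/forall_inP => v; rewrite inE => /andP[vS /exists_inP[u uS uv]].
rewrite deg_in_setC; case: v vS uv => [[a|c]|[a i]] vS uv.
- have [[e|e] E] := Sg _ uS; rewrite E in uv;
    case: a vS uv => [[e'|e']|f]; rewrite ?SB // /adj /entry_val.
- rewrite deg_check.
  have [e eH Ke] := hH c.
  pose h (x : option U) := if x is Some e' then vB e' else vU e.
  set d := deg_in _ _ _; suff : #|U|.+1 <= d by lia.
  rewrite -card_option -cardsT -(card_imset _ (_ : injective h)); last first.
    by move=> [?|] [?|] // [->].
  apply: subset_leq_card; apply/subsetP => _ /imsetP[[e'|] _ ->] /=; rewrite inE.
    by rewrite SB.
  by rewrite SU eH /adj /entry_val /= Ke.
- have Na w : adj (vL a i) w = (w == vA a) by exact: adj_leaf.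
  have Sa : vA a \in S by move: uv; rewrite adj_sym Na => /eqP <-.
  rewrite (_ : [set _ | _] = [set vA a]); last by apply/setP => w; rewrite !inE Na.
  rewrite cards1 /deg_in (_ : [set _ in S | _] = [set vA a]) ?cards1 //.
  by apply/setP => w; rewrite !inE Na; case: eqP => [->|]; rewrite ?andbT ?andbF.
Qed.

Hypothesis covering : forall e, exists c, K (c, e).

(** By [heavy] a false vertex would bring in its whole clique, which exceeds the budget. What
    remains forces the whole base into [S], leaving room for at most [k] element vertices, and these
    must hit every check. *)
Lemma hitting_of_alliance (S : {set vertex}) : offensive_alliance adj S ->
  #|S| <= alliance_size -> exists2 H : {set U}, #|H| <= k & hitting H.
Proof.
move=> oS cS; have heavyS := heavy cS oS.
have SF f : vF f \notin S.
  apply/negP => Sf; suff: alliance_size < #|S| by rewrite ltnNge cS.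
  have -> : alliance_size.+1 = #|{: option U + 'I_k}|.
    by rewrite card_sum card_option card_ord.
  rewrite -cardsT -(card_imset _ (_ : injective vF)); last by move=> ? ? [].
  apply: subset_leq_card; apply/subsetP => _ /imsetP[f' _ ->].
  case: (eqVneq f f') => [<- //|ff']; apply: heavyS; exists (vF f) => //.
  by rewrite /adj /entry_val /= ff'.
(* A check in [S] would force its neighbour, the last false vertex, into [S]. *)
have SC c : vC c \notin S.
  by apply/negP => Sc; have /negP[] := SF (inl None); apply: heavyS; exists (vC c).
have checked c a : vA a \in S -> adj (vC c) (vA a) -> #|U| < deg_in adj S (vC c).
  move=> Sa ca; have := oS; case/andP=> _ /forall_inP /(_ (vC c)).
  rewrite deg_in_setC deg_check => H; suff: vC c \in open_nbh adj S by move/H; lia.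
  by apply: (open_nbhI Sa); rewrite ?SC // adj_sym.
have SA : exists a, vA a \in S.
  have := oS; case/andP=> /set0Pn[[[a|c]|[a i]] Sv] _; first by exists a.
    by have := SC c; rewrite Sv.
  exists a; apply: heavyS; exists (vL a i) => //; by rewrite adj_leaf.
(* An element vertex in [S] has, by [covering], an adjacent check. That check needs more than [#|U|]
   neighbours in [S], and element vertices alone supply at most [#|U|]. *)
have [e0 Se0] : exists e, vB e \in S.
  case: SA => [[[e|e]|f]] Sa; [by exists e| |by have := SF f; rewrite Sa].
  have [c Kc] := covering e.
  have : #|U| < deg_in adj S (vC c).
    by apply: (checked c _ Sa); rewrite /adj /entry_val /= Kc.
  case: (pickP (fun e => vB e \in S)) => [e' He'|SB]; first by exists e'.
  rewrite ltnNge => /negP[].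
  rewrite -cardsT -(card_imset _ (_ : injective vU)); last by move=> ? ? [].
  apply: subset_leq_card; apply/subsetP => v; rewrite inE => /andP[Sv].
  case: v Sv => [[[[e'|e']|f]|d]|[a i]] Sv // _.
  - by have := SB e'; rewrite Sv.
  - by apply: imset_f; rewrite inE.
  - by have := SF f; rewrite Sv.
have SB e : vB e \in S.
  case: (eqVneq e0 e) => [<- //|ee0]; apply: heavyS; exists (vB e0) => //.
  by rewrite /adj /entry_val /= ee0.
pose H := [set e | vU e \in S].
have inj_U : injective vU by move=> ? ? [].
have inj_B : injective vB by move=> ? ? [].
have cH : #|vB @: [set: U] :|: vU @: H| = #|U| + #|H|.
  rewrite cardsU !card_imset // cardsT (_ : _ :&: _ = set0) ?cards0 ?subn0 //.
  by apply/setP => v; rewrite !inE; apply/andP => -[] /imsetP[? _ ->] /imsetP[].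
exists H => [|c].
  rewrite -(leq_add2l #|U|) -cH; apply: leq_trans cS; apply: subset_leq_card.
  apply/subsetP => v; rewrite inE => /orP[] /imsetP[e]; last by rewrite inE => ? ->.
  by move=> _ ->.
(* Every check is adjacent to the base; without an element of [H] its neighbours in [S] are base
   vertices only, which are too few. *)
have := checked c _ (Se0 : vA (coreB e0) \in S) isT; apply: contraPP => nH.
apply/negP; rewrite -leqNgt -cardsT -(card_imset _ inj_B).
apply: subset_leq_card; apply/subsetP => v; rewrite inE => /andP[Sv].
case: v Sv => [[[[e|e]|f]|d]|[a i]] Sv // Ke.
- by apply: imset_f; rewrite inE.
- by case: nH; exists e; rewrite ?inE.
- by have := SF f; rewrite Sv.
Qed.

Theorem alliance_hitting : 0 < #|U| ->
  (exists S, offensive_alliance adj S /\ 1 <= #|S| <= alliance_size) <->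
  (exists2 H : {set U}, #|H| <= k & hitting H).
Proof.
move=> U0; split=> [[S [oS /andP[_ cS]]]|[H cH hH]].
  exact: hitting_of_alliance oS cS.
exact: alliance_of_hitting cH hH.
Qed.

Hypothesis size_gt0 : 0 < alliance_size.

Definition oa_adj_of : rel 'I_#|vertex| :=
  fun i j => adj (enum_val i) (enum_val j).

Definition oa_of : oa_instance :=
  @OAInstance #|vertex| oa_adj_of (fun _ _ => adj_sym _ _) (fun _ => adj_irr _)
    alliance_size size_gt0.

Lemma oa_of_yes : 0 < #|U| ->
  oa_yes oa_of <-> exists2 H : {set U}, #|H| <= k & hitting H.
Proof.
move=> U0; rewrite -alliance_hitting //.
symmetry; exact: (iso_alliance (enum_val_bij vertex) (fun _ _ => erefl)).
Qed.

Definition oa_param_of : nat := alliance_size + (3 * #|U| + k + 1).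

(** The value does not depend on [K], so the advice can write it as a constant. *)
Lemma oa_of_param : oa_param oa_of = oa_param_of.
Proof.
rewrite /oa_param /= -(iso_vertex_cover_number (enum_val_bij vertex) (fun _ _ => erefl)).
by rewrite vertex_cover_number_adj.
Qed.

End HittingSet.

(** * The encoded graph as a list of entries *)

Section Encoding.

Variables (U Chk : finType) (k : nat).
Local Notation vertex := (vertex U Chk k).

Definition encode_entries : seq (entry (Chk * U)) :=
  nseq #|vertex| (true, None) ++ (false, None) ::
  [seq adj_entry (enum_val u) (enum_val v) | u <- enum 'I_#|vertex|, v <- enum 'I_#|vertex|] ++
  nseq (alliance_size U k) (true, None).

Lemma oa_of_encode (K : Chk * U -> bool) (r0 : 0 < alliance_size U k) :
  oa_encode (oa_of K r0) = map (entry_val K) encode_entries.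
Proof.
rewrite /oa_encode /encode_entries map_cat map_nseq /= map_cat map_nseq; congr (_ ++ _ :: _ ++ _).
by rewrite map_allpairs.
Qed.

Lemma size_encode_entries :
  size encode_entries = #|vertex| + (#|vertex| * #|vertex| + alliance_size U k).+1.
Proof.
by rewrite /encode_entries size_cat size_nseq /= size_cat size_nseq size_allpairs size_enum_ord.
Qed.

Lemma card_vertex : #|vertex| =
  3 * #|U| + k + 1 + #|Chk| + (3 * #|U| + k + 1) * (2 * alliance_size U k).
Proof.
rewrite !(card_sum, card_prod) card_option !card_ord.
by have -> : #|U| + #|U| + (#|U|.+1 + k) = 3 * #|U| + k + 1 by lia.
Qed.

End Encoding.

(** * From constraint satisfaction to hitting set *)

Section ConstraintHitting.

Variables (B D : finType) (m n : nat).
Variables (bad : B * D -> B * D -> B * D -> B * D -> B * D -> bool).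
Variables (read0 : D -> cell) (cellvar : 'I_n -> B).

(* The values of the [m] selector variables name one of the [#|D| ^ m] composed
   inputs; the checks indexed by [selector * 'I_n] copy the input named by the
   solution into the constraint system.  Each variable has one vertex per
   value, and the budget [#|csp_var|] allows one value per variable. *)
Definition selector : finType := {ffun 'I_m -> D}.
Definition csp_var : finType := (B + 'I_m)%type.
Definition csp_universe : finType := (csp_var * D)%type.
Definition csp_check : finType :=
  (((B * D) * (B * D) * (B * D) * (B * D) * (B * D)) + csp_var +
   (selector * 'I_n))%type.

(** A tuple check holds the values avoiding a bad tuple, or everything if the tuple is not bad; a
    variable check holds all values of its variable; a copy check [(s, p)] holds the selector values
    differing from [s] and the values of [cellvar p] that read as the input bit. *)
Definition csp_entry (ce : csp_check * csp_universe) : entry (selector * 'I_n) :=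
  match ce with
  | (inl (inl (a0, a1, a2, a3, a4)), (inl b, d)) =>
    (bad a0 a1 a2 a3 a4 ==>
       has (fun a => (b == a.1) && (d != a.2)) [:: a0; a1; a2; a3; a4], None)
  | (inl (inl (a0, a1, a2, a3, a4)), (inr _, _)) => (~~ bad a0 a1 a2 a3 a4, None)
  | (inl (inr v), (v', _)) => (v == v', None)
  | (inr (s, p), (inr j, d)) => (d != s j, None)
  | (inr (s, p), (inl b, d)) =>
    if b == cellvar p then
      match read0 d with
      | None => (false, None)
      | Some b' => (~~ b', Some (s, p))
      end
    else (false, None)
  end.

Lemma card_csp_var : #|csp_var| = #|B| + m.
Proof. by rewrite card_sum card_ord. Qed.

Lemma card_csp_universe : #|csp_universe| = (#|B| + m) * #|D|.
Proof. by rewrite card_prod card_csp_var. Qed.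

Lemma card_csp_check : let g := #|B| * #|D| in
  #|csp_check| = g * g * g * g * g + (#|B| + m) + #|D| ^ m * n.
Proof. by rewrite !(card_sum, card_prod) card_ffun !card_ord. Qed.

Variable xs : selector * 'I_n -> bool.

Definition csp_solution (sigma : B -> D) (s : selector) : Prop :=
  (forall b0 b1 b2 b3 b4, ~~ bad (b0, sigma b0) (b1, sigma b1) (b2, sigma b2)
                                 (b3, sigma b3) (b4, sigma b4)) /\
  (forall p, read0 (sigma (cellvar p)) = Some (xs (s, p))).

Definition csp_incidence (ce : csp_check * csp_universe) : bool :=
  entry_val xs (csp_entry ce).

Definition assigned (sigma : B -> D) (s : selector) (v : csp_var) : D :=
  match v with inl b => sigma b | inr j => s j end.

Lemma csp_covering e : exists c, csp_incidence (c, e).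
Proof.
by case: e => v d; exists (inl (inr v)); rewrite /csp_incidence /entry_val /= eqxx.
Qed.

Lemma hitting_assigned (H : {set csp_universe}) sigma s :
  (forall v d, ((v, d) \in H) = (d == assigned sigma s v)) ->
  hitting csp_incidence H <-> csp_solution sigma s.
Proof.
move=> HE; rewrite /csp_incidence; split=> [hH|[H1 H2] [[[[[[a0 a1] a2] a3] a4]|v]|[s' p]]].
- split=> [b0 b1 b2 b3 b4|p].
    apply/negP => Hb.
    have [[v d]] := hH (inl (inl ((b0, sigma b0), (b1, sigma b1), (b2, sigma b2),
      (b3, sigma b3), (b4, sigma b4)))).
    rewrite HE => /eqP ->; rewrite /entry_val /=.
    case: v => [b|j] /=; rewrite Hb //=.
    have F b' : (b == b') && (sigma b != sigma b') = false.
      by case: eqP => //= ->; rewrite eqxx.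
    by rewrite !F.
  (* No selector value in [H] differs from [s], so this check is hit at [cellvar p]. *)
  have [[v d]] := hH (inr (s, p)); rewrite HE => /eqP ->; rewrite /entry_val /=.
  case: v => [b|j] /=; last by rewrite eqxx.
  case: eqP => [->|//]; case: (read0 _) => [[]|] //=.
    by move=> ->.
  by case: (xs _).
- case Hb : (bad a0 a1 a2 a3 a4).
    have : has (fun a => sigma a.1 != a.2) [:: a0; a1; a2; a3; a4].
      apply: contraT => /hasPn Ha.
      have E a : a \in [:: a0; a1; a2; a3; a4] -> a = (a.1, sigma a.1).
        by move/Ha/negPn/eqP => ->; case: (a).
      have := H1 a0.1 a1.1 a2.1 a3.1 a4.1.
      by rewrite -!E ?inE ?eqxx ?orbT // Hb.
    case/hasP => a Ha Na; exists (inl a.1, sigma a.1); first by rewrite HE.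
    have : has (fun a' => (a.1 == a'.1) && (sigma a.1 != a'.2)) [:: a0; a1; a2; a3; a4].
      by apply/hasP; exists a => //; rewrite eqxx.
    by rewrite /entry_val /= Hb addbF.
  exists (inl a0.1, sigma a0.1); first by rewrite HE.
  by rewrite /entry_val /= addbF Hb.
- by exists (v, assigned sigma s v); rewrite ?HE // /entry_val /= eqxx.
- case: (eqVneq s' s) => [->|].
    exists (inl (cellvar p), sigma (cellvar p)); first by rewrite HE.
    by rewrite /entry_val /= eqxx H2 /=; case: (xs _).
  (* For an input not named by the solution, a differing selector value already hits the check. *)
  move=> ss'; suff /existsP[j Hj] : [exists j, s j != s' j].
    by exists (inr j, s j); rewrite ?HE // /entry_val /= addbF.
  apply: contraR ss'; rewrite negb_exists => /forallP E.
  by apply/eqP/ffunP => j; have /negPn/eqP := E j.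
Qed.

(** Variable checks demand a value for each variable and the budget allows no more, so a hitting set
    is the graph of an assignment. *)
Lemma csp_hitting :
  (exists2 H : {set csp_universe}, #|H| <= #|csp_var| & hitting csp_incidence H) <->
  (exists sigma s, csp_solution sigma s).
Proof.
split=> [[H cH hH]|[sigma [s H]]]; last first.
  exists [set vd | vd.2 == assigned sigma s vd.1].
    rewrite -cardsT -(card_imset [set: csp_var] (_ : injective (fun v => (v, assigned sigma s v)))).
      apply: subset_leq_card; apply/subsetP => -[v d]; rewrite inE /= => /eqP ->.
      by apply: imset_f; rewrite inE.
    by move=> v v' [].
  by apply/hitting_assigned; last exact: H; move=> v d; rewrite inE.
have /choice[tau Htau] : forall v, exists d, (v, d) \in H.
  move=> v; have [[v' d] vdH] := hH (inl (inr v)).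
  by rewrite /csp_incidence /entry_val /= addbF => /eqP ->; exists d.
have HE : [set (v, tau v) | v in [set: csp_var]] = H.
  apply/eqP; rewrite eqEcard card_imset => [|v v' []//]; rewrite cardsT cH andbT.
  by apply/subsetP => _ /imsetP[v _ ->].
exists (fun b => tau (inl b)), [ffun j => tau (inr j)].
apply/hitting_assigned; last exact: hH; move=> v d.
have -> : assigned (fun b => tau (inl b)) [ffun j => tau (inr j)] v = tau v.
  by case: v => //= j; rewrite ffunE.
rewrite -HE; apply/imsetP/eqP => [[v' _ [-> ->]] //|->].
by exists v; rewrite ?inE.
Qed.

End ConstraintHitting.

(** * Computation tableaux *)

Lemma cont_Posz s (i : nat) : cont s i = nth None (map Some s) i.
Proof. by []. Qed.

Lemma cont_neg s z : (z < 0)%R -> cont s z = None.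
Proof. by case: z => // i _; rewrite /cont /= nth_nil. Qed.

Lemma cont_default s (i : nat) : size s <= i -> cont s i = None.
Proof. by move=> H; rewrite cont_Posz nth_default // size_map. Qed.

Lemma nth_bits_upto_blank_monotone r :
  (forall i, nth None r i = None -> nth None r i.+1 = None) ->
  forall i, nth None (map Some (bits_upto_blank r)) i = nth None r i.
Proof.
elim: r => [|[b|] r IH] Hr [|i] //=; first by rewrite IH // => j /(Hr j.+1).
by elim: i => [|i IHi]; apply/esym; [exact: (Hr 0)|exact: (Hr i.+1)].
Qed.

Lemma size_bits_upto_blank r : size (bits_upto_blank r) <= size r.
Proof. by elim: r => [|[]]. Qed.

Section Tableau.

Variable M : turing_machine.
Let K := (tm_tapes M).+1.

(* A row of the tableau lists head-relative slices of all tapes, each carrying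
   the state.  A slice depends on three slices of the previous row and on its
   central one, which holds the scanned symbols.  The boundary slices are left
   unconstrained: their influence cannot reach the centre within [T] steps. *)
Definition slice_type : finType := (tm_state M * {ffun 'I_K -> cell})%type.

Definition slice (c : config M) (z : int) : slice_type :=
  (c.1, [ffun i => tape_fun (c.2 i) z]).

Lemma slice2 c z i : (slice c z).2 i = tape_fun (c.2 i) z.
Proof. by rewrite ffunE. Qed.

Definition update (z : int) (dl d dr d0 : slice_type) : slice_type :=
  if tm_halt d0.1 then (d0.1, d.2) else
  let: (q, act) := tm_delta d0.1 d0.2 in
  (q, [ffun i => if (z + offset (act i).2 == 0)%R then (act i).1 else
        (match (act i).2 with MoveLeft => dl | Stay => d | MoveRight => dr end).2 i]).

Lemma slice_step c z : slice (tm_step c) z =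
  update z (slice c (z - 1)%R) (slice c z) (slice c (z + 1)%R) (slice c 0%R).
Proof.
rewrite /slice /tm_step /update /=; case: c => q ts /=; case: tm_halt => //.
have -> : [ffun i => tape_read (ts i)] = [ffun i => tape_fun (ts i) 0%R].
  by apply/ffunP => i; rewrite !ffunE tape_readE.
case: tm_delta => q' act /=; congr (_, _); apply/ffunP => i.
by rewrite !ffunE tape_funP; case: (act i).2; rewrite !ffunE /= ?addr0.
Qed.

Variables (n mw T : nat).

(** Row [tau] is determined up to distance [radius - tau]; the [+ 1] keeps cells 0 and 1 determined
    in row [T], and [n + mw] makes room for both strings. *)
Definition radius : nat := T + n + mw + 1.
Definition tableau_pos : finType := ('I_T.+1 * 'I_(2 * radius).+1)%type.

Definition coord (j : 'I_(2 * radius).+1) : int := (Posz j - Posz radius)%R.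

Definition position (z : int) : 'I_(2 * radius).+1 := inord (`|(z + radius)%R|).

Lemma positionK z : (- Posz radius <= z <= Posz radius)%R -> coord (position z) = z.
Proof. by move=> H; rewrite /coord /position inordK; lia. Qed.

(** A missing tape counts as blank, since [M] may have a single tape. *)
Definition tape_no (i : nat) (d : slice_type) : cell :=
  if insub i : option 'I_K is Some j then d.2 j else None.

Definition bad_start (b : tableau_pos) (d : slice_type) : bool :=
  (b.1 == 0 :> nat) &&
  ((d.1 != tm_start M) ||
   [exists i : 'I_K, (d.2 i != None) &&
     ~~ ((0 <= coord b.2)%R &&
         (coord b.2 < Posz (nth 0 [:: n; mw] i))%R)]).

(** Rules out a symbol just after a blank, so that the initial witness tape holds a single bit
    string. *)
Definition bad_gap (b b' : tableau_pos) (d d' : slice_type) : bool :=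
  [&& b.1 == 0 :> nat, b'.1 == 0 :> nat, (0 <= coord b.2)%R,
      (coord b'.2 == coord b.2 + 1)%R, tape_no 1 d == None & tape_no 1 d' != None].

Definition bad_step (b bl bc br b0 : tableau_pos) (d dl dc dr d0 : slice_type) : bool :=
  [&& b.1 == bl.1.+1 :> nat, bl.1 == bc.1, br.1 == bc.1, b0.1 == bc.1,
      (coord bl.2 == coord b.2 - 1)%R, (coord bc.2 == coord b.2)%R,
      (coord br.2 == coord b.2 + 1)%R, (coord b0.2 == 0)%R &
      d != update (coord b.2) dl dc dr d0].

Definition bad_end (b : tableau_pos) (d : slice_type) : bool :=
  (b.1 == T :> nat) &&
  ((coord b.2 == 0)%R && ~~ (tm_halt d.1 && (d.2 ord0 == Some true)) ||
   (coord b.2 == 1)%R && (d.2 ord0 != None)).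

(** Five arguments serve a step: a slice, its three predecessors and the scanned slice. The other
    constraints use fewer. *)
Definition tableau_bad (a0 a1 a2 a3 a4 : tableau_pos * slice_type) : bool :=
  [|| bad_start a0.1 a0.2, bad_gap a0.1 a1.1 a0.2 a1.2,
      bad_step a0.1 a1.1 a2.1 a3.1 a4.1 a0.2 a1.2 a2.2 a3.2 a4.2
    | bad_end a0.1 a0.2].

Definition input_pos (p : 'I_n) : tableau_pos := (ord0, position (Posz p)).

Definition tableau_ok (sigma : tableau_pos -> slice_type) : Prop :=
  forall b0 b1 b2 b3 b4, ~~ tableau_bad (b0, sigma b0) (b1, sigma b1)
    (b2, sigma b2) (b3, sigma b3) (b4, sigma b4).

Variables (V : 2.-tuple bitseq -> bitseq) (pV : {poly nat}).
Hypothesis M_V : forall xs : 2.-tuple bitseq,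
  computes_within M pV.[sumn (map size xs)]%R xs (V xs).
Hypothesis T_large : forall w : bitseq, size w <= mw -> pV.[n + size w]%R <= T.

Variable x : n.-tuple bool.

Lemma run_output (w : bitseq) : size w <= mw ->
  let c := iter T (@tm_step M) (tm_init M [:: tval x; w]) in
  tm_halt c.1 /\ tm_output c = V [tuple tval x; w].
Proof.
move=> Hw /=; have [H E] := M_V [tuple tval x; w].
have HT : pV.[sumn (map size [tuple tval x; w])]%R <= T.
  by rewrite /= size_tuple addn0; exact: T_large.
by rewrite (iter_halted_leq HT H).
Qed.

Lemma output_trueP (c : config M) :
  tm_output c = [:: true] <->
  tape_fun (c.2 ord0) 0%R = Some true /\ tape_fun (c.2 ord0) 1%R = None.
Proof.
rewrite /tm_output /=; case: (c.2 ord0).2 => [|[[]|] [|[b|] r]] //=; split=> // -[] //.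
Qed.

Lemma tableau_of_run (w : bitseq) : size w <= mw -> V [tuple tval x; w] = [:: true] ->
  exists sigma, tableau_ok sigma /\
    forall p, (sigma (input_pos p)).2 ord0 = Some (tnth x p).
Proof.
move=> Hw Vw; have [] := run_output Hw.
set c0 := tm_init M _; rewrite Vw /= => hT /output_trueP[o0 o1].
pose sigma (b : tableau_pos) := slice (iter b.1 (@tm_step M) c0) (coord b.2).
have c0E i z : tape_fun (c0.2 i) z = cont (nth [::] [:: tval x; w] i) z.
  by rewrite ffunE.
exists sigma; split=> [b0 b1 b2 b3 b4|p]; last first.
  rewrite /sigma /slice /= ffunE c0E /= positionK; last by have := ltn_ord p; rewrite /radius; lia.
  by rewrite cont_Posz (nth_map false) ?size_tuple // (tnth_nth false).
rewrite /tableau_bad /= !negb_or; apply/and4P; split.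
- apply/negP => /andP[/eqP b00] /orP[]; first by rewrite /sigma b00 /= eqxx.
  case/existsP => i /andP[]; rewrite /sigma b00 /= ffunE c0E => H /negP[]; move: H.
  case: (ltrP (coord b0.2) 0) => [Hz|]; first by rewrite cont_neg.
  case: (coord b0.2) => // j _ H /=; apply: contraR H; rewrite -leNgt lez_nat => H.
  rewrite cont_default //; apply: leq_trans H.
  by case: (nat_of_ord i) => [|[|i']] //=; rewrite ?size_tuple ?nth_nil.
- apply/negP => /and5P[/eqP b00 /eqP b10 H0 /eqP H1 /andP[]].
  rewrite /tape_no; case: insubP => // i _ Hi; rewrite /sigma b00 b10 /= ffunE c0E ffunE c0E Hi /=.
  rewrite H1; case: (coord b0.2) H0 => // j _; 
  have -> : (Posz j + 1)%R = Posz j.+1 by lia.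
  rewrite !cont_Posz.
  case: (ltnP j (size w)) => Hj; first by rewrite (nth_map false).
  by rewrite [in X in _ -> X]nth_default // size_map; exact: leqW.
- apply/negP => /and5P[/eqP E01 /eqP E12 /eqP E32 /eqP E42 /and5P[/eqP F1 /eqP F2 /eqP F3 /eqP F4]].
  by rewrite /sigma E01 F1 F2 F3 F4 E32 E42 -E12 iterS slice_step eqxx.
- apply/negP => /andP[/eqP bT] /orP[] /andP[/eqP Hz]; rewrite /sigma bT Hz slice2.
    by rewrite o0 eqxx andbT => /negP[].
  by rewrite o1.
Qed.

(** The witness is read off row 0. By induction on [tau], row [tau] agrees with the run up to
    distance [radius - tau], hence at the output cells of row [T]. *)
Lemma run_of_tableau (sigma : tableau_pos -> slice_type) : tableau_ok sigma ->
  (forall p, (sigma (input_pos p)).2 ord0 = Some (tnth x p)) ->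
  exists w : bitseq, size w <= mw /\ V [tuple tval x; w] = [:: true].
Proof.
move=> ok inx.
have startP b : ~~ bad_start b (sigma b).
  by have := ok b b b b b; rewrite /tableau_bad !negb_or => /and4P[].
have gapP b b' : ~~ bad_gap b b' (sigma b) (sigma b').
  by have := ok b b' b b b; rewrite /tableau_bad !negb_or => /and4P[].
have stepP b b1 b2 b3 b4 :
    ~~ bad_step b b1 b2 b3 b4 (sigma b) (sigma b1) (sigma b2) (sigma b3) (sigma b4).
  by have := ok b b1 b2 b3 b4; rewrite /tableau_bad !negb_or => /and4P[].
have endP b : ~~ bad_end b (sigma b).
  by have := ok b b b b b; rewrite /tableau_bad !negb_or => /and4P[].
pose row (tau : nat) (z : int) : tableau_pos := (inord tau, position z).
pose r := [seq tape_no 1 (sigma (row 0 (Posz i))) | i <- iota 0 mw].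
pose w := bits_upto_blank r.
have Hw : size w <= mw.
  by rewrite -[X in _ <= X](size_iota 0) -(size_map (fun i : nat => tape_no 1 (sigma (row 0 (Posz i))))); exact: size_bits_upto_blank.
exists w; split=> //; have [hT <-] := run_output Hw.
set c0 := tm_init M _ in hT *.
have c0E i z : tape_fun (c0.2 i) z = cont (nth [::] [:: tval x; w] i) z.
  by rewrite ffunE.
have blankP z i : (- Posz radius <= z <= Posz radius)%R -> (sigma (row 0 z)).2 i != None ->
    (0 <= z < Posz (nth 0 [:: n; mw] i))%R.
  move=> Hz; have := startP (row 0 z); rewrite /bad_start /= inordK //= negb_or.
  case/andP => _ /existsPn /(_ i); rewrite negb_and !negbK positionK //.
  by case/orP => [/eqP -> /eqP|/andP[-> ->]].
have wE (i : nat) : nth None (map Some w) i = nth None r i.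
  apply: nth_bits_upto_blank_monotone => {}i.
  case: (ltnP i.+1 mw) => Hi; last by move=> _; rewrite nth_default // size_map size_iota.
  rewrite !(nth_map 0) ?size_iota // 1?ltnW // !nth_iota // 1?ltnW // => E.
  have := gapP (row 0 (Posz i)) (row 0 (Posz i.+1)).
  rewrite /bad_gap /= inordK //= !positionK; try (rewrite /radius; lia).
  rewrite add0n E eqxx /= -addn1 eqxx /= negbK => /eqP.
  by [].
(* Tape 0 is fixed by the input constraints, tape 1 by the choice of [w], and the others are
   blank. *)
have init z : (- Posz radius <= z <= Posz radius)%R -> sigma (row 0 z) = slice c0 z.
  move=> Hz; case Es : (sigma (row 0 z)) => [q ts]; congr (_, _).
    have := startP (row 0 z); rewrite /bad_start /= inordK //= negb_or.
    by rewrite Es /= negbK => /andP[/eqP].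
  apply/ffunP => i; rewrite ffunE c0E.
  have Ei : ts i = (sigma (row 0 z)).2 i by rewrite Es.
  rewrite Ei; have := blankP z i Hz; case: z Hz {Es Ei} => [j|j] Hz; last first.
    by rewrite cont_neg //; case: eqP => // _ /(_ isT).
  rewrite cont_Posz /= ltz_nat => Hb.
  case: (leqP (nth 0 [:: n; mw] i) j) => Hj.
    rewrite nth_default; last first.
      rewrite size_map; apply: leq_trans Hj.
      by case: (nat_of_ord i) => [|[|i']] //=; rewrite ?size_tuple ?nth_nil.
    by move: Hb; rewrite ltnNge Hj; case: eqP => // _ /(_ isT).
  case Hi: (nat_of_ord i) Hj {Hb} => [|[|i']] /= Hj; last by rewrite nth_nil in Hj.
    have -> : i = ord0 by apply: val_inj.
    rewrite (nth_map false) ?size_tuple //.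
    have := inx (Ordinal Hj); rewrite (tnth_nth false) /= => <-.
    by congr ((sigma (_, _)).2 _); apply: val_inj; rewrite /= inordK.
  rewrite wE (nth_map 0) ?size_iota // nth_iota // /tape_no.
  case: insubP => [i1 _ Hi1|]; last by rewrite -Hi ltn_ord.
  by have -> : i1 = i by apply: ord_inj; rewrite Hi.
have run tau z : tau <= T -> (- Posz (radius - tau) <= z <= Posz (radius - tau))%R ->
    sigma (row tau z) = slice (iter tau (@tm_step M) c0) z.
  elim: tau z => [|tau IH] z Ht Hz; first by apply: init; lia.
  have := stepP (row tau.+1 z) (row tau (z - 1)%R) (row tau z) (row tau (z + 1)%R) (row tau 0%R).
  have Hr : radius = T + n + mw + 1 by [].
  rewrite /bad_step /= !inordK; try lia.
  rewrite !positionK; try lia.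
  by rewrite !eqxx /= negbK => /eqP ->; rewrite slice_step !IH //; lia.
have Hr : radius = T + n + mw + 1 by [].
apply/output_trueP; have := endP (row T 0%R); have := endP (row T 1%R).
rewrite /bad_end /= !inordK // eqxx /= !positionK; try lia.
rewrite !run //; try lia.
by rewrite !slice2 /= negbK => /eqP ->; rewrite orbF negbK => /andP[_ /eqP ->].
Qed.

Lemma tableauP :
  (exists sigma, tableau_ok sigma /\
     forall p, (sigma (input_pos p)).2 ord0 = Some (tnth x p)) <->
  (exists w : bitseq, size w <= mw /\ V [tuple tval x; w] = [:: true]).
Proof.
split=> [[sigma [ok inx]]|[w [Hw Vw]]]; first exact: run_of_tableau ok inx.
exact: tableau_of_run Hw Vw.
Qed.

End Tableau.

(** * The covering argument of Fortnow and Santhanam *)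

(** Strings of length at most [s] become strings of length [s + 1], so that the fibres are indexed
    by a finite type with [2 ^ s.+1] elements. *)
Definition padded (s : nat) (y : bitseq) : bitseq :=
  y ++ true :: nseq (s - size y) false.

Lemma padded_inj s y y' : size y <= s -> size y' <= s ->
  padded s y = padded s y' -> y = y'.
Proof.
suff H z z' : size z <= s -> size z' <= s -> padded s z = padded s z' ->
    ~~ (size z < size z').
  move=> Hy Hy' E; have := H _ _ Hy Hy' E; have := H _ _ Hy' Hy (esym E).
  rewrite -!leqNgt => L L'; have Es : size y = size y' by lia.
  by have := congr1 (take (size y)) E; rewrite take_size_cat // Es take_size_cat.
move=> Hz Hz' E; apply/negP => L; have := congr1 (fun u => nth false u (size z')) E.
rewrite /padded [RHS]nth_cat ltnn subnn /= nth_cat ltnNge ltnW //=.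
by case Ed: (size z' - size z) => [|d]; [lia|rewrite /= nth_nseq if_same].
Qed.

Section Distillation.

Variables (X I : finType).

Definition touched (Y : eqType) (F : {ffun I -> X} -> Y) (N : {set X}) (y : Y) : {set X} :=
  [set x | [exists q : {ffun I -> X},
     [&& q \in ffun_on [in N], F q == y & [exists i, q i == x]]]].

(* Otherwise every fibre of [F] on [N ^ I] has fewer than [(#|N| / 2) ^ #|I|]
   elements, since it is included in [touched F N y ^ I]. *)
Lemma large_touched (Y : finType) (F : {ffun I -> X} -> Y) (N : {set X}) :
  0 < #|I| -> #|Y| <= 2 ^ #|I| -> N != set0 ->
  exists y, #|N| <= 2 * #|touched F N y|.
Proof.
move=> I0 cY N0; apply/existsP; apply: contraT; rewrite negb_exists => /forallP small.
have sumN : #|N| ^ #|I| <= \sum_(y : Y) #|touched F N y| ^ #|I|.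
  rewrite -(card_ffun_on I [in N]) -sum1_card (partition_big F xpredT) //=.
  apply: leq_sum => y _; rewrite sum1_card -card_ffun_on; apply: subset_leq_card.
  apply/subsetP => q; rewrite !inE => /andP[qN /eqP Fq]; apply/ffun_onP => i.
  rewrite inE; apply/existsP; exists q; rewrite qN Fq eqxx /=.
  by apply/existsP; exists i.
have [y0 _] : exists y : Y, true.
  have [x xN] := set0Pn _ N0; by exists (F [ffun=> x]).
(* There are at most [2 ^ #|I|] terms, each below [#|N| ^ #|I|] by [small]; the term at [y0] makes
   the total strictly smaller. *)
suff : \sum_(y : Y) (2 * #|touched F N y|) ^ #|I| < 2 ^ #|I| * #|N| ^ #|I|.
  under eq_bigr => y _ do rewrite expnMn.
  by rewrite -big_distrr /= ltn_mul2l => /andP[_]; rewrite ltnNge sumN.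
apply: leq_trans (leq_mul cY (leqnn (#|N| ^ #|I|))).
rewrite -sum_nat_const; apply: (@leq_trans (\sum_(y : Y) ((2 * #|touched F N y|) ^ #|I|).+1)).
  under [X in _ <= X]eq_bigr => y _ do rewrite -addn1.
  by rewrite big_split /= sum1_card -addn1 leq_add2l; apply/card_gt0P; exists y0.
by apply: leq_sum => y _; rewrite ltn_exp2r // ltnNge.
Qed.

(** Each string from [large_touched] settles at least half of the remaining set, so [j] strings
    exhaust fewer than [2 ^ j] elements. *)
Lemma touched_cover (F : {ffun I -> X} -> bitseq) (s : nat) (P : pred X) j (N : {set X}) :
  0 < #|I| -> s < #|I| -> (forall q, size (F q) <= s) ->
  {in N, forall x, P x} -> #|N| < 2 ^ j ->
  exists ys : seq bitseq,
    [/\ size ys <= j,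
        {in ys, forall y, exists2 q : {ffun I -> X}, forall i, P (q i) & F q = y} &
        {in N, forall x, exists q : {ffun I -> X}, [/\ forall i, P (q i), F q \in ys & exists i, q i = x]}].
Proof.
move=> I0 sI sF; elim: j N => [|j IH] N PN cN.
  exists [::]; split=> // x xN; move: cN; rewrite expn0 ltnS leqn0 cards_eq0 => /eqP N0.
  by rewrite N0 inE in xN.
have [N0|N0] := eqVneq N set0.
  by exists [::]; split=> // x; rewrite N0 inE.
have size_pad q : size (padded s (F q)) == s.+1.
  by rewrite size_cat /= size_nseq addnS subnKC.
pose F' q : s.+1.-tuple bool := Tuple (size_pad q).
have [|y' Hy'] := large_touched F' I0 _ N0.
  by rewrite card_tuple card_bool leq_exp2l.
have F'E q q' : F' q = F' q' -> F q = F q'.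
  by move/(congr1 val); exact: padded_inj.
have touchedP x : x \in touched F' N y' ->
    exists q : {ffun I -> X}, [/\ forall i, q i \in N, F' q = y' & exists i, q i = x].
  rewrite inE => /existsP[q /and3P[/ffun_onP qN /eqP Fq /existsP[i /eqP E]]].
  by exists q; split=> //; exists i.
(* A touched element shows that the tuple [y'] is the padding of an actual value of [F]. *)
have [x0 x0t] : exists x, x \in touched F' N y'.
  have N1 : 0 < #|N| by rewrite card_gt0.
  apply/set0Pn; rewrite -card_gt0 -(ltn_pmul2l (isT : 0 < 2)) muln0.
  exact: leq_trans N1 Hy'.
have [q0 [q0N Fq0 _]] := touchedP _ x0t.
have [x /setDP[xN _]||ys [cys ysP ysN]] := IH (N :\: touched F' N y'); last 1 first.
- exists (F q0 :: ys); split=> //.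
    move=> y; rewrite inE => /orP[/eqP ->|]; last exact: ysP.
    by exists q0 => // i; exact: PN.
  move=> x xN; case: (boolP (x \in touched F' N y')) => xt.
    have [q [qN Fq xq]] := touchedP _ xt; exists q; split=> //; first by move=> i; exact: PN.
    by rewrite inE (F'E q q0) ?eqxx // Fq Fq0.
  have [|q [qP Fq xq]] := ysN x; first by rewrite inE xt.
  by exists q; split=> //; rewrite inE Fq orbT.
- exact: PN.
have tN : touched F' N y' \subset N.
  by apply/subsetP => x /touchedP[q [qN _ [i <-]]].
have Ht : #|N| <= 2 * #|touched F' N y'| := Hy'.
by rewrite cardsD (setIidPr tN); move: cN Ht; rewrite expnS; lia.
Qed.

End Distillation.

(** * Polynomial bounds *)

Lemma poly_bound (p : {poly nat}) : exists C e, forall n, p.[n]%R <= C * n.+1 ^ e.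
Proof.
elim/poly_ind: p => [|p a [C [e IH]]]; first by exists 0, 0 => n; rewrite horner0.
exists (C + a), e.+1 => n; rewrite hornerD hornerM hornerX hornerC.
rewrite mulnDl leq_add //; last by rewrite leq_pmulr // expn_gt0.
by rewrite expnS mulnCA mulnC leq_mul.
Qed.

Lemma poly_leq_exp2 (p : {poly nat}) : exists c, forall n, c <= n -> p.[n]%R <= 2 ^ n.
Proof.
have [C [e pC]] := poly_bound p; pose d := e.+1.
exists (C * d ^ d) => n Hn; apply: leq_trans (pC n) _.
have d0 : 0 < d ^ d by rewrite expn_gt0.
rewrite -(leq_pmul2l d0) mulnA [_ * C]mulnC.
(* With [d = e + 1]: [(n + 1) ^ d <= d ^ d * (n %/ d + 1) ^ d <= d ^ d * 2 ^ n]. *)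
apply: (@leq_trans (n.+1 ^ d)).
  by rewrite [n.+1 ^ d]expnS leq_mul2r (leq_trans Hn) ?orbT.
apply: (@leq_trans ((d * (n %/ d).+1) ^ d)).
  by rewrite leq_exp2r // mulnC -ltn_divLR.
rewrite expnMn leq_mul2l; apply/orP; right.
apply: (@leq_trans ((2 ^ (n %/ d)) ^ d)); first by rewrite leq_exp2r // ltn_expl.
by rewrite -expnM leq_exp2l // leq_trunc_div.
Qed.

Definition poly_bounded (g : nat -> nat) : Prop :=
  exists p : {poly nat}, forall n, g n <= p.[n]%R.

Lemma poly_bounded_leq g g' : (forall n, g n <= g' n) -> poly_bounded g' -> poly_bounded g.
Proof. by move=> H [p Hp]; exists p => n; exact: leq_trans (H n) (Hp n). Qed.

Lemma poly_bounded_const c : poly_bounded (fun=> c).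
Proof. by exists (c%:P)%R => n; rewrite hornerC. Qed.

Lemma poly_bounded_id : poly_bounded id.
Proof. by exists 'X%R => n; rewrite hornerX. Qed.

Lemma poly_boundedD g g' : poly_bounded g -> poly_bounded g' ->
  poly_bounded (fun n => g n + g' n).
Proof. by move=> [p Hp] [q Hq]; exists (p + q)%R => n; rewrite hornerD leq_add. Qed.

Lemma poly_boundedM g g' : poly_bounded g -> poly_bounded g' ->
  poly_bounded (fun n => g n * g' n).
Proof. by move=> [p Hp] [q Hq]; exists (p * q)%R => n; rewrite hornerM leq_mul. Qed.

Lemma poly_boundedS g : poly_bounded g -> poly_bounded (fun n => (g n).+1).
Proof.
move=> Hg; apply: poly_bounded_leq (poly_boundedD Hg (poly_bounded_const 1)) => n.
by rewrite addn1.
Qed.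

Lemma poly_bounded_horner (p : {poly nat}) g : poly_bounded g ->
  poly_bounded (fun n => p.[g n]%R).
Proof.
by case=> q Hq; exists (p \Po q)%R => n; rewrite horner_comp; exact: horner_leq.
Qed.

Ltac poly_bounded := repeat first
  [ assumption | apply: poly_bounded_const | apply: poly_bounded_id
  | apply: poly_boundedD | apply: poly_boundedM | apply: poly_boundedS
  | apply: poly_bounded_horner ].

(** * Advice programs writing an encoded instance *)

Section Programs.

Variables (S : finType) (n : nat).

(** Substitution: constants combine by xor, so the result is again a constant or a possibly negated
    bit. *)
Definition entry_bind (B C : Type) (g : B -> entry C) (e : entry B) : entry C :=
  if e.2 is Some b then (e.1 (+) (g b).1, (g b).2) else (e.1, None).

Lemma entry_val_bind B C (g : B -> entry C) (beta : C -> bool) e :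
  entry_val beta (entry_bind g e) = entry_val (fun b => entry_val beta (g b)) e.
Proof. by case: e => c [b|]; rewrite /entry_val /= ?addbA. Qed.

(** The witness lists the components of the family one after the other, [n] bits each. *)
Definition bit_offset (sp : S * 'I_n) : nat := enum_rank sp.1 * n + sp.2.

Variable s : S.

(* The component [s] of the family is read from the input, the others from the
   witness. *)
Definition compile (e : entry (S * 'I_n)) : seq instr :=
  match e.2 with
  | None => [:: PushC e.1]
  | Some (s', p) =>
    if s' == s then
      nseq p (MoveX true) ++ PushX e.1 :: nseq p (MoveX false)
    else let k := bit_offset (s', p) in
      nseq k (MoveW true) ++ PushW e.1 :: nseq k (MoveW false)
  end.

(** Strings grow leftwards, hence the reversal; the [k] marks write the parameter in unary. *)
Definition program (entries : seq (entry (S * 'I_n))) (k : nat) : seq instr :=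
  flatten (map compile (rev entries)) ++ nseq k Mark.

Lemma all_plain_program entries k : all plain (program entries k).
Proof.
rewrite all_cat all_nseq orbT andbT; elim: (rev entries) => //= -[c o] es IH.
rewrite all_cat IH andbT /compile; case: o => [[s' p]|] //=.
by case: ifP => _; rewrite all_cat /= !all_nseq !orbT.
Qed.

Lemma bit_offset_lt sp : bit_offset sp < #|S| * n.
Proof.
apply: (@leq_trans (enum_rank sp.1 * n + n)); first by rewrite ltn_add2l.
by rewrite addnC -mulSn leq_mul.
Qed.

Lemma size_compile e : size (compile e) <= (2 * (n + #|S| * n)).+1.
Proof.
case: e => c [[s' p]|] //; rewrite /compile /=; have Hp := ltn_ord p.
case: ifP => _; rewrite size_cat /= !size_nseq; last first.
  by move: (bit_offset_lt (s', p)); set t := _ * _; set u := bit_offset _; lia.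
by move: Hp; set t := _ * _; set u := nat_of_ord p; lia.
Qed.

Lemma size_program entries k :
  size (program entries k) <= size entries * (2 * (n + #|S| * n)).+1 + k.
Proof.
rewrite size_cat size_nseq leq_add2r size_flatten /shape -map_comp -size_rev.
elim: (rev entries) => //= e es IH; rewrite mulSn leq_add //; exact: size_compile.
Qed.

Variables (x w : bitseq) (pw : int).

Definition fetched (sp : S * 'I_n) : bool :=
  if sp.1 == s then is_set (cont x (Posz sp.2))
  else is_set (cont w (pw + Posz (bit_offset sp))%R).

Lemma exec_moves_x k b (px : int) (pw' : int) s0 s1 :
  foldl (exec x w) (MState true px pw' s0 s1) (nseq k (MoveX b)) =
  MState true (px + (if b then Posz k else - Posz k))%R pw' s0 s1.
Proof.
elim: k px => [|k IH] px /=; first by case: b; rewrite ?oppr0 addr0.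
by rewrite /exec /= addr0 IH; congr MState; case: {IH} b => /=; lia.
Qed.

Lemma exec_moves_w k b (px : int) (pw' : int) s0 s1 :
  foldl (exec x w) (MState true px pw' s0 s1) (nseq k (MoveW b)) =
  MState true px (pw' + (if b then Posz k else - Posz k))%R s0 s1.
Proof.
elim: k pw' => [|k IH] pw' /=; first by case: b; rewrite ?oppr0 addr0.
by rewrite /exec /= addr0 IH; congr MState; case: {IH} b => /=; lia.
Qed.

Lemma exec_compile e s0 s1 :
  foldl (exec x w) (MState true 0 pw s0 s1) (compile e) =
  MState true 0 pw (entry_val fetched e :: s0) s1.
Proof.
case: e => c [[s' p]|]; last by rewrite /= /exec /= !addr0 /entry_val /= addbF.
rewrite /compile /entry_val /fetched /=; case: ifP => _.
  rewrite foldl_cat exec_moves_x /= {2}/exec /= !addr0 exec_moves_x add0r.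
  by congr MState; lia.
rewrite foldl_cat exec_moves_w /= {2}/exec /= !addr0 exec_moves_w.
by congr MState; lia.
Qed.

Lemma exec_program entries k :
  foldl (exec x w) (MState true 0 pw [::] [::]) (program entries k) =
  MState true 0 pw (map (entry_val fetched) entries) (nseq k true).
Proof.
rewrite foldl_cat.
have -> : foldl (exec x w) (MState true 0 pw [::] [::]) (flatten (map compile (rev entries))) =
    MState true 0 pw (map (entry_val fetched) entries) [::].
  elim: entries => //= e es IH.
  by rewrite rev_cons map_rcons flatten_rcons foldl_cat IH exec_compile.
rewrite -[X in nseq X true]addn0 -[[::]]/(nseq 0 true : bitseq).
elim: k 0 => [|k IH] l //=.
by rewrite {2}/exec /= !addr0 (IH l.+1) addnS.
Qed.

End Programs.

(** * Acceptance through the selected block *)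

Section Accepts.

Variables (x w : bitseq) (f : 2.-tuple bitseq -> bitseq).

Definition block_result (b : seq instr * bitseq) (pw : int) : bool :=
  let st := foldl (exec x w) (MState true 0 pw [::] [::]) b.1 in
  f [tuple ms_0 st; ms_1 st] == b.2.

(** The position [pw'] may stay arbitrary: soundness will hold for whatever family the witness
    spells from there. *)
Lemma accepts_sound bs pw : accepts x w f bs pw ->
  exists i, i < size bs /\ exists pw', block_result (nth ([::], [::]) bs i) pw'.
Proof.
elim: bs pw => //= b bs IH pw; case: ifP => _ => [E|/IH [i Hi]].
  by exists 0; split=> //; exists (pw + 1)%R.
by exists i.+1.
Qed.

(** Block [i] reads the witness from [i.+1] on, just past the bit that selects it. *)
Lemma accepts_complete bs i (pw : int) : i < size bs ->
  (forall j, j < i -> ~~ is_set (cont w (pw + Posz j)%R)) ->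
  is_set (cont w (pw + Posz i)%R) ->
  block_result (nth ([::], [::]) bs i) (pw + Posz i.+1)%R ->
  accepts x w f bs pw.
Proof.
elim: bs i pw => //= b bs IH [|i] pw Hi Hj; first by rewrite addr0 => ->.
have := Hj 0 isT; rewrite addr0 => /negbTE -> H1 H2.
have E (j : nat) : (pw + 1 + Posz j = pw + Posz j.+1)%R by lia.
by apply: (IH i) => [//|j Hji||]; rewrite E //; exact: (Hj j.+1).
Qed.

End Accepts.

(** * Composition and advice *)

Section Composition.

Variables (M : turing_machine) (V : 2.-tuple bitseq -> bitseq) (pV pw : {poly nat}).
Hypothesis M_V : forall xs : 2.-tuple bitseq,
  computes_within M pV.[sumn (map size xs)]%R xs (V xs).

Variables (n m : nat).

Let mw : nat := pw.[n]%R.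
Let T : nat := pV.[(n + mw)%N]%R.
Let B := tableau_pos n mw T.
Let D := slice_type M.

Definition index_type : finType := selector D m.
Definition oa_universe : finType := csp_universe B D m.
Definition oa_checks : finType := csp_check B D m n.
Definition var_count : nat := #|csp_var B m|.

Definition incidence_entry : oa_checks * oa_universe -> entry (index_type * 'I_n) :=
  csp_entry (@tableau_bad M n mw T) (fun d : D => d.2 ord0) (@input_pos n mw T).

Implicit Types q : {ffun index_type -> n.-tuple bool}.

Definition input_bit q (sp : index_type * 'I_n) : bool := tnth (q sp.1) sp.2.

Definition incidence q (cu : oa_checks * oa_universe) : bool :=
  entry_val (input_bit q) (incidence_entry cu).

Lemma oa_universe_gt0 : 0 < #|oa_universe|.
Proof.
apply/card_gt0P; exists (inl (ord0, ord0), (tm_start M, [ffun=> None])).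
by rewrite inE.
Qed.

Lemma composed_size_gt0 : 0 < alliance_size oa_universe var_count.
Proof. by rewrite /alliance_size addn_gt0 oa_universe_gt0. Qed.

Definition composed q : oa_instance := oa_of (incidence q) composed_size_gt0.

(** This is the OR of the members' verdicts, through the chain from alliances to hitting sets,
    constraints and tableaux. *)
Lemma composed_yes q : oa_yes (composed q) <->
  exists s, exists w : bitseq, size w <= pw.[n]%R /\ V [tuple tval (q s); w] = [:: true].
Proof.
rewrite oa_of_yes ?oa_universe_gt0 //; last exact: csp_covering.
have TL (w : bitseq) : size w <= mw -> pV.[(n + size w)%N]%R <= T.
  by move=> Hw; apply: horner_leq; rewrite leq_add2l.
rewrite csp_hitting; split=> [[sigma [s [ok inx]]]|[s]]; last first.
  case/(tableauP M_V TL) => sigma [ok inx]; exists sigma, s.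
  by split; [exact: ok|move=> p; rewrite inx].
by exists s; apply/(tableauP M_V TL); exists sigma; split; [exact: ok|exact: inx].
Qed.

Definition composed_param : nat := oa_param_of oa_universe var_count.

Lemma composed_paramE q : oa_param (composed q) = composed_param.
Proof. exact: oa_of_param. Qed.

Definition composed_entries : seq (entry (index_type * 'I_n)) :=
  map (entry_bind incidence_entry) (encode_entries oa_universe oa_checks var_count).

Lemma composed_encode q :
  oa_encode (composed q) = map (entry_val (input_bit q)) composed_entries.
Proof.
rewrite oa_of_encode -map_comp; apply: eq_map => e /=.
by rewrite entry_val_bind.
Qed.

Section Advice.

Variables (f : 2.-tuple bitseq -> bitseq) (R : language) (pc : {poly nat}).
Hypothesis f_compression : forall I : oa_instance,
  let y := f [tuple oa_encode I; nseq (oa_param I) true] in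
  size y <= pc.[oa_param I]%R /\ (R y <-> oa_yes I).

Variable L : language.
Hypothesis L_V : forall x, ~ L x <->
  exists w : bitseq, size w <= pw.[size x]%R /\ V [tuple x; w] = [:: true].

Definition compressed q : bitseq :=
  f [tuple map (entry_val (input_bit q)) composed_entries; nseq composed_param true].

Lemma compressedP q : size (compressed q) <= pc.[composed_param]%R /\
  (R (compressed q) <-> exists s, ~ L (q s)).
Proof.
have := f_compression (composed q); rewrite composed_paramE composed_encode => -[Hs HR].
split=> //; rewrite HR composed_yes; split=> -[s H]; exists s.
  by apply/L_V; rewrite size_tuple.
by move/L_V: H; rewrite size_tuple.
Qed.

(** Blank witness cells count as clear bits, so every witness spells a family. *)
Definition fetched_family (s : index_type) (x : n.-tuple bool) (w : bitseq) (pos : int) :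
    {ffun index_type -> n.-tuple bool} :=
  [ffun s' => [tuple fetched s x w pos (s', p) | p < n]].

Lemma fetched_family_self s x w pos : fetched_family s x w pos s = x.
Proof.
apply: eq_from_tnth => p; rewrite ffunE tnth_mktuple /fetched eqxx cont_Posz.
rewrite (nth_map false) ?size_tuple // -tnth_nth /is_set.
by case: (tnth x p).
Qed.

Lemma block_resultE (x : n.-tuple bool) w s y pos :
  block_result x w f (program s composed_entries composed_param, y) pos =
  (compressed (fetched_family s x w pos) == y).
Proof.
rewrite /block_result exec_program /=; congr (f _ == y).
apply: val_inj; congr [:: _; _]; apply: eq_map => -[c [[s' p]|]] //=.
by rewrite /entry_val /= /input_bit /= ffunE tnth_mktuple.
Qed.

Definition tuple_bits q (s0 : index_type) : bitseq :=
  mkseq (fun i => nth false (q (nth s0 (enum index_type) (i %/ n))) (i %% n))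
        (#|index_type| * n).

Lemma tuple_bits_nth q s0 s p :
  nth false (tuple_bits q s0) (bit_offset (s, p)) = tnth (q s) p.
Proof.
have n0 : 0 < n by exact: leq_ltn_trans (ltn_ord p).
rewrite nth_mkseq ?bit_offset_lt // /bit_offset /= divnMDl // divn_small // addn0.
by rewrite nth_enum_rank modnMDl modn_small // -tnth_nth.
Qed.

Hypothesis m_large : pc.[composed_param]%R < #|D| ^ m.

(** There is one block per position [s] and listed string [y]. Soundness: [y] comes from a family
    inside [L], so it is not in [R], whereas a family containing some [x] outside [L] is compressed
    into [R]. Completeness: [touched_cover] puts [x] in a family inside [L] that compresses to a
    listed string. *)
Lemma advice_blocks : exists bs : seq (seq instr * bitseq),
  [/\ all (fun b => all plain b.1) bs,
      size bs <= n.+1 * #|index_type|,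
      all (fun b => (size b.1 <= size composed_entries * (2 * (n + #|index_type| * n)).+1
                                + composed_param) &&
                    (size b.2 <= pc.[composed_param]%R)) bs &
      forall x, size x = n ->
        (forall w, accepts x w f bs 0 -> L x) /\
        (L x -> exists w : bitseq,
           size w <= n.+1 * #|index_type| + #|index_type| * n /\ accepts x w f bs 0)].
Proof.
have cI : #|index_type| = #|D| ^ m by rewrite card_ffun card_ord.
pose N := [set x : n.-tuple bool | `[< L x >]].
(* The exponent is [n.+1] because [N] may have all [2 ^ n] elements. *)
have [|||||ys [cys ysP ysN]] := @touched_cover _ index_type compressed pc.[composed_param]%R
  (fun x => `[< L x >]) n.+1 N.
- by rewrite cI; exact: leq_ltn_trans m_large.
- by rewrite cI.
- by move=> q; case: (compressedP q).
- by move=> x; rewrite inE.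
- by rewrite (leq_ltn_trans (max_card _)) // card_tuple card_bool ltn_exp2l.
pose prs : seq (index_type * bitseq) := [seq (s, y) | y <- ys, s <- enum index_type].
pose block_of (sy : index_type * bitseq) :=
  (program sy.1 composed_entries composed_param, sy.2).
pose bs := map block_of prs.
have prsP s y : ((s, y) \in prs) = (y \in ys).
  apply/allpairsP/idP => [[[y' s'] [/= Hy _ [_ ->]]] //|Hy].
  by exists (y, s); rewrite mem_enum.
have sbs : size bs = size ys * #|index_type| by rewrite size_map size_allpairs -cardE.
have bsP i : i < size bs -> exists s y, y \in ys /\
    nth ([::], [::]) bs i = (program s composed_entries composed_param, y).
  rewrite size_map => Hi.
  have s0 : index_type by exact: [ffun=> (tm_start M, [ffun=> None])].
  rewrite (nth_map (s0, [::])) //; have := mem_nth (s0, [::]) Hi.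
  by case: nth => s y; rewrite prsP => Hy; exists s, y.
exists bs; split.
- by rewrite all_map; apply/allP => -[s y] _; exact: all_plain_program.
- by rewrite sbs leq_mul2r cys orbT.
- rewrite all_map; apply/allP => -[s y]; rewrite prsP => Hy /=.
  rewrite size_program /=; have [q _ <-] := ysP y Hy.
  by case: (compressedP q).
move=> x Hx; have -> : x = tval (Tuple (introT eqP Hx)) by [].
move: (Tuple _) => {Hx}x; split=> [w /accepts_sound[i [Hi [pos]]]|Lx].
  have [s [y [Hy ->]]] := bsP i Hi; rewrite block_resultE => /eqP E.
  have [q' Hq' Eq'] := ysP y Hy.
  apply: contrapT => NL; have [_ [_ HR]] := compressedP (fetched_family s x w pos).
  have [HR' _] := (compressedP q').2.
  case: HR'; first by rewrite Eq' -E; apply: HR; exists s; rewrite fetched_family_self.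
  by move=> s'; apply; apply/asboolP.
have [|q [qL Fq [s qs]]] := ysN x; first by rewrite inE; apply/asboolP.
have [i Hi Ei] : exists2 i, i < size bs &
    nth ([::], [::]) bs i = (program s composed_entries composed_param, compressed q).
  have Hsy : (s, compressed q) \in prs by rewrite prsP.
  exists (index (s, compressed q) prs); first by rewrite size_map index_mem.
  by rewrite (nth_map (s, compressed q)) ?index_mem // nth_index.
(* [i] clear bits and a set bit select block [i]; the family follows. *)
exists (nseq i false ++ true :: tuple_bits q s); split.
  rewrite size_cat size_nseq /= size_mkseq addnS -addSn leq_add2r.
  by rewrite (leq_trans Hi) // sbs leq_mul2r cys orbT.
have nthw j : cont (nseq i false ++ true :: tuple_bits q s) (Posz j) =
    nth None (nseq i (Some false) ++ Some true :: map Some (tuple_bits q s)) j.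
  by rewrite cont_Posz map_cat map_nseq.
apply: (accepts_complete Hi) => [j Hj||]; rewrite ?add0r.
- by rewrite nthw nth_cat size_nseq Hj nth_nseq Hj.
- by rewrite nthw nth_cat size_nseq ltnn subnn.
rewrite Ei block_resultE; apply/eqP; congr compressed; apply/ffunP => s'.
apply: eq_from_tnth => p; rewrite ffunE tnth_mktuple /fetched -[(s', p).1]/s' -[(s', p).2]/p.
case: eqP => [->|_].
  rewrite cont_Posz (nth_map false) ?size_tuple // -tnth_nth qs /is_set.
  by case: (tnth x p).
have -> : (Posz i.+1 + Posz (bit_offset (s', p)))%R = Posz (i + (bit_offset (s', p)).+1) by lia.
rewrite nthw nth_cat size_nseq ltnNge leq_addr /= addKn /=.
rewrite (nth_map false) ?size_mkseq ?bit_offset_lt // tuple_bits_nth.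
by rewrite /is_set; case: (tnth _ _).
Qed.

End Advice.

End Composition.

Lemma size_codes p : size (codes p) <= 14 * size p.
Proof.
elim: p => // i p IH; rewrite codes_cons size_cat /= mulnS leq_add //.
by rewrite /unary size_rcons size_nseq; exact: instr_code_lt.
Qed.

Lemma size_advice P Y (bs : seq (seq instr * bitseq)) :
  all (fun b => (size b.1 <= P) && (size b.2 <= Y)) bs ->
  size (codes (flatten (map block bs))) <= 14 * (size bs * (P + Y + 3)).
Proof.
move=> Hbs; apply: leq_trans (size_codes _) _; rewrite leq_mul2l /=.
elim: bs Hbs => //= b bs IH /andP[/andP[HP HY] /IH H].
rewrite size_cat /= size_cat /= size_rcons size_map.
rewrite mulSn; move: HP HY H; set t := size bs * _; set u := size (flatten _).
by move: (size b.1) (size b.2) u t => i j u t; lia.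
Qed.

(** * Polynomial bounds on composed instances *)

Section PolynomialSizes.

Variables (M : turing_machine) (pV pw : {poly nat}).
Let delta : nat := #|slice_type M|.
Let grid (n : nat) : nat := #|{: tableau_pos n pw.[n]%R pV.[(n + pw.[n]%R)%N]%R}|.
(** Alliance size plus vertex cover number, for [v] variables with [delta] values each. *)
Let param (v : nat) : nat := v * delta + v + (3 * (v * delta) + v + 1).

Lemma card_slice_type_gt1 : 1 < delta.
Proof.
apply/card_gt1P; exists (tm_start M, [ffun=> None]), (tm_start M, [ffun=> Some true]).
by split=> //; apply/eqP => -[/ffunP/(_ ord0)]; rewrite !ffunE.
Qed.

Lemma composed_param_grid n m : composed_param M pV pw n m = param (grid n + m).
Proof.
rewrite /composed_param /oa_param_of /alliance_size /oa_universe /var_count /csp_universe.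
by rewrite card_csp_universe card_csp_var.
Qed.

Lemma poly_bounded_grid : poly_bounded grid.
Proof.
apply: (@poly_bounded_leq _ (fun n => (pV.[(n + pw.[n]%R)%N]%R).+1 *
  (2 * (pV.[(n + pw.[n]%R)%N]%R + n + pw.[n]%R + 1)).+1)) => [n|].
  by rewrite /grid card_prod !card_ord.
poly_bounded.
Qed.

Variable pc : {poly nat}.

(* The parameter itself depends on the number [m] of selectors, but only
   linearly, while the number of composed inputs is [delta ^ m]. *)
Lemma selector_length_exists : exists (c : nat) (m : nat -> nat),
  [/\ forall n, m n <= n + c,
      forall n, pc.[composed_param M pV pw n (m n)]%R < delta ^ m n &
      poly_bounded (fun n => delta ^ m n)].
Proof.
have [pb Hpb] := poly_bounded_grid; have d1 := card_slice_type_gt1.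
have [H HH] : poly_bounded (fun z => (pc.[param (pb.[z]%R + z)]%R).+1).
  by rewrite /param; poly_bounded.
have [c Hc] := poly_leq_exp2 H.
(* [m] is the logarithm of [H] at [n + c]. The shift by [c] gives [H] at most [2 ^ (n + c)] there,
   so [m n <= n + c]; with that bound, [H] at [n + c] exceeds the compressed length. *)
have m_leq n : up_log delta H.[(n + c)%N]%R <= n + c.
  apply: up_log_min => //; apply: leq_trans (Hc _ (leq_addl n c)) _.
  by case: (n + c) => // z; rewrite leq_exp2r.
exists c, (fun n => up_log delta H.[(n + c)%N]%R); split=> // [n|].
  apply: leq_trans (up_logP _ d1); apply: leq_trans (HH _).
  rewrite ltnS; apply: horner_leq; rewrite composed_param_grid /param.
  have : grid n + up_log delta H.[(n + c)%N]%R <= pb.[(n + c)%N]%R + (n + c).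
    by rewrite leq_add // (leq_trans (Hpb n)) // horner_leq // leq_addr.
  move: (grid n + _) (_ + (n + c)) => v v' vv.
  by rewrite !leq_add // ?leq_mul // leq_mul.
apply: (@poly_bounded_leq _ (fun n => delta * H.[(n + c)%N]%R)); last by poly_bounded.
move=> n; have H0 : 0 < H.[(n + c)%N]%R by exact: leq_ltn_trans (HH _).
(* Minimality of the logarithm gives [delta ^ (m n).-1 < H], so one more factor [delta] bounds the
   power. *)
case: (ltnP 1 H.[(n + c)%N]%R) => H1.
  have := up_log_gtn d1 H1; have : 0 < up_log delta H.[(n + c)%N]%R by rewrite up_log_gt0 d1.
  by case: up_log => // k _ /ltnW; rewrite expnS leq_mul2l => ->; rewrite orbT.
have -> : up_log delta H.[(n + c)%N]%R = 0 by apply/eqP; rewrite up_log_eq0 H1 orbT.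
by rewrite expn0 muln_gt0 H0 andbT ltnW.
Qed.

Lemma poly_bounded_sizes (m : nat -> nat) c : (forall n, m n <= n + c) ->
  poly_bounded (fun n => delta ^ m n) ->
  [/\ poly_bounded (fun n => composed_param M pV pw n (m n)),
      poly_bounded (fun n => #|index_type M (m n)|) &
      poly_bounded (fun n => size (composed_entries M pV pw n (m n)))].
Proof.
move=> m_leq Pt; have Pg := poly_bounded_grid.
have Pm : poly_bounded m.
  by apply: poly_bounded_leq m_leq _; poly_bounded.
have Pi : poly_bounded (fun n => #|index_type M (m n)|).
  by apply: poly_bounded_leq Pt => n; rewrite card_ffun card_ord.
have Pk : poly_bounded (fun n => composed_param M pV pw n (m n)).
  apply: (@poly_bounded_leq _ (fun n => param (grid n + m n))) => [n|].
    by rewrite composed_param_grid.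
  by rewrite /param; poly_bounded.
split=> //.
(* Following [card_vertex]: [v] counts variables, [a] core vertices, [h] checks and [o] all
   vertices; [r] is the alliance size. *)
pose v n := grid n + m n.
have Pv : poly_bounded v by rewrite /v; poly_bounded.
pose r n := v n * delta + v n.
have Pr : poly_bounded r by rewrite /r; poly_bounded.
pose a n := 3 * (v n * delta) + v n + 1.
have Pa : poly_bounded a by rewrite /a; poly_bounded.
pose g n := grid n * delta.
have Pg' : poly_bounded g by rewrite /g; poly_bounded.
pose h n := g n * g n * g n * g n * g n + v n + delta ^ m n * n.
have Ph : poly_bounded h by rewrite /h; poly_bounded.
pose o n := a n + h n + a n * (2 * r n).
have Po : poly_bounded o by rewrite /o; poly_bounded.
apply: (@poly_bounded_leq _ (fun n => o n + (o n * o n + r n).+1)) => [n|]; last by poly_bounded.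
have u_eq : #|oa_universe M pV pw n (m n)| = v n * delta by exact: card_csp_universe.
have k_eq : var_count pV pw n (m n) = v n by exact: card_csp_var.
rewrite size_map size_encode_entries card_vertex /alliance_size u_eq k_eq.
by rewrite card_csp_check -/delta.
Qed.

End PolynomialSizes.

(** * From a compression to membership in NP/poly *)

Theorem theorem4 :
  ~ (forall L : language, coNP L -> NP_poly L) ->
  ~ admits_poly_compression OffensiveAlliance.
Proof.
move=> H [R [f [pc [[Mf [pf Mf_f]] f_compression]]]]; apply: H => L.
case=> V [pw [[M [pV M_V]] L_V]].
have [c [m [m_leq m_large Pt]]] := selector_length_exists M pV pw pc.
have [Pk Pi Pe] := poly_bounded_sizes pV pw m_leq Pt.
have adv n := advice_blocks M_V f_compression L_V (m_large n).
(* Advice need not be computable, so a block list is simply chosen for each length. *)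
have [bs Hbs] := choice adv.
pose size_bs n := n.+1 * #|index_type M (m n)|.
have Ps : poly_bounded size_bs by rewrite /size_bs; poly_bounded.
have [q Hq] : poly_bounded (fun n => 14 * (size_bs n *
   (size (composed_entries M pV pw n (m n)) * (2 * (n + #|index_type M (m n)| * n)).+1 +
     composed_param M pV pw n (m n) + pc.[composed_param M pV pw n (m n)]%R + 3))).
  by poly_bounded.
have [p Hp] : poly_bounded (fun n => size_bs n + #|index_type M (m n)| * n) by poly_bounded.
exists (vm_output Mf pf), p, q, (fun n => codes (flatten (map block (bs n)))); split.
- exact: vm_poly_time Mf_f.
- move=> n; have [_ Hs Hb _] := Hbs n; apply: leq_trans (Hq n).
  apply: leq_trans (size_advice Hb) _.
  by rewrite leq_mul2l leq_mul2r Hs !orbT.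
move=> x; have [Hpl _ _ HL] := Hbs (size x); have [HL1 HL2] := HL x erefl.
split=> [/HL2[w [Hw acc]]|[w [_ /(vm_outputP Mf_f _ _ Hpl) acc]]]; last exact: HL1 acc.
exists w; split; first exact: leq_trans Hw (Hp _).
exact/(vm_outputP Mf_f).
Qed.
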